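(* Let $(p,\mathbf s,\mathbf u):[0,T]\to W\times\tilde W\times V$ be the solution of the problem: for all $t\in(0,T)$, $$(p_t,w)+(\nabla\cdot\mathbf u,w)=(f,w)\ \ \forall w\in W,\qquad (\mathbf u,\mathbf z)+(K(|\mathbf s|)\mathbf s,\mathbf z)=0\ \ \forall \mathbf z\in\tilde W,\qquad (\mathbf s,\mathbf v)+(p,\nabla\cdot\mathbf v)=0\ \ \forall\mathbf v\in V,$$ with $p(x,0)=p_0(x)$ in $\Omega$ and $\mathbf u\cdot\nu=0$ on $\Gamma\times[0,T]$. Let $0<t_0<T$. Then there is a constant $C>0$ (of the type described in the context) such that for each $t\in[t_0,T]$, $$\|p_t(t)\|^2\le C\,t_0^{-1}\mathcal M(t_0)+C\Big(\mathcal M(t)+\int_0^t\|f_t(\tau)\|^2d\tau\Big),$$ where $$\mathcal M(t)=\|\mathbf s^0\|_{L^\beta(\Omega)}^\beta+\|p^0\|^2+2\int_0^t\|f(\tau)\|^2d\tau+t\Big(\|p^0\|+\int_0^T\|f(\tau)\|\,d\tau\Big)^2.$$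
   Context: $\Omega\subset\mathbb R^d$, $d\ge2$, is a bounded domain with boundary $\Gamma$ of class $C^2$ and outward normal $\nu$; $0<T<\infty$; $f\in C^1([0,T];L^\infty(\Omega))$ and the initial datum $p_0$ are given. The weak solution is assumed to be sufficiently regular in both $x$ and $t$. Function $K$: let $g(s)=a_0s^{\alpha_0}+a_1s^{\alpha_1}+\cdots+a_Ns^{\alpha_N}$ for $s\ge0$, with $N\ge1$, fixed exponents $0=\alpha_0<\alpha_1<\dots<\alpha_N$, coefficients $a_i\ge0$, $a_0>0$, $a_N>0$. For $\xi\ge0$ let $s(\xi)\ge0$ be the solution of $s\,g(s)=\xi$, and set $K(\xi)=1/g(s(\xi))$. Set $a=\alpha_N/(\alpha_N+1)\in(0,1)$ and $\beta=2-a$. Spaces: $W=L^2(\Omega)$, $\tilde W=(L^2(\Omega))^d$, $V=\{\mathbf v\in(L^2(\Omega))^d:\nabla\cdot\mathbf v\in L^2(\Omega),\ \mathbf v\cdot\nu=0\text{ on }\Gamma\}$. $(\cdot,\cdot)$ is the $L^2(\Omega)$ or $(L^2(\Omega))^d$ inner product and $\|\cdot\|$ the corresponding norm. For a function $\varphi$ of $(x,t)$, $\|\varphi(t)\|=\|\varphi(\cdot,t)\|$ and $\varphi^0=\varphi(\cdot,0)$. $C$ denotes a positive constant depending only on the exponents and coefficients of $g$, on $d$ and on $\Omega$ (independent of the initial and boundary data). *)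

(* Defs.v *)
From HB Require Import structures.
From mathcomp Require Import all_boot all_order all_algebra.
From mathcomp Require Import all_classical all_reals all_analysis.
Set Implicit Arguments.
Unset Strict Implicit.
Unset Printing Implicit Defensive.
Import Order.TTheory GRing.Theory Num.Theory.
Import numFieldNormedType.Exports.
Local Open Scope classical_set_scope.
Local Open Scope ring_scope.

(* 'rV[R]_n with the product sigma-algebra, which is its Borel sigma-algebra. *)
Fact rV_display : measure_display -> measure_display. Proof. exact. Qed.

Section rV_measurable.
Context {R : realType} {n : nat}.
Let coord (i : 'I_n) (x : 'rV[R]_n) : R := x ord0 i.

Let rV_set0 : g_sigma_preimage coord set0.
Proof. exact: sigma_algebra0. Qed.
Let rV_setC A : g_sigma_preimage coord A -> g_sigma_preimage coord (~` A).
Proof. exact: sigma_algebraC. Qed.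
Let rV_bigcup (F : _^nat) : (forall i, g_sigma_preimage coord (F i)) ->
  g_sigma_preimage coord (\bigcup_i (F i)).
Proof. exact: sigma_algebra_bigcup. Qed.

HB.instance Definition _ :=
  @isMeasurable.Build (rV_display default_measure_display) 'rV[R]_n
  (g_sigma_preimage coord) rV_set0 rV_setC rV_bigcup.

Lemma measurable_coord (i : 'I_n) :
  measurable_fun [set: 'rV[R]_n] (fun x => x ord0 i).
Proof.
move=> _ Y mY; rewrite setTI; apply: sub_sigma_algebra => /=.
rewrite -bigcup_seq/=; exists i => /=; first by rewrite mem_index_enum.
by exists Y => //; rewrite setTI.
Qed.

Lemma measurable_rV d (T : measurableType d) (f : T -> 'rV[R]_n) :
  (forall i, measurable_fun setT (fun x => f x ord0 i)) -> measurable_fun setT f.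
Proof.
move=> mf.
suff sub : g_sigma_preimage coord `<=` [set A | measurable (f @^-1` A)].
  by move=> _ A mA; rewrite setTI; exact: sub.
apply: smallest_sub; first split.
- by rewrite /= preimage_set0.
- by move=> A /= mA; rewrite setTD preimage_setC; exact: measurableC.
- by move=> F /= mF; rewrite preimage_bigcup; exact: bigcupT_measurable.
move=> A; rewrite -bigcup_seq => -[i _ [B mB <-]] /=.
by rewrite setTI -comp_preimage -[X in measurable X]setTI; apply: mf.
Qed.

End rV_measurable.

Section lebesgue_rV.
Context {R : realType}.

Definition rV_cons n (z : R * 'rV[R]_n) : 'rV[R]_n.+1 := row_mx z.1%:M z.2.

Lemma rV_cons0 n z : @rV_cons n z ord0 ord0 = z.1.
Proof.
have E : ord0 = lshift n ord0 :> 'I_(1 + n) by apply: val_inj.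
rewrite -[LHS]/(row_mx _ _ _ (ord0 : 'I_(1 + n))) E.
by rewrite row_mxEl mxE mulr1n.
Qed.

Lemma rV_consS n z i : @rV_cons n z ord0 (lift ord0 i) = z.2 ord0 i.
Proof.
have E : lift ord0 i = rshift 1 i :> 'I_(1 + n) by apply: val_inj.
by rewrite -[LHS]/(row_mx _ _ _ (lift ord0 i : 'I_(1 + n))) E row_mxEr.
Qed.

Lemma measurable_rV_cons n : measurable_fun setT (@rV_cons n).
Proof.
apply: measurable_rV => i; case: (unliftP ord0 i) => [j ->|->].
  rewrite (_ : (fun x => _) = (fun x : R * 'rV[R]_n => x.2 ord0 j)); last first.
    by apply/funext => x; exact: rV_consS.
  exact: (measurableT_comp (measurable_coord j)).
rewrite (_ : (fun x => _) = fst)//; last first.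
  by apply/funext => x; exact: rV_cons0.
Qed.

Section step.
Variables (n : nat) (mu : {sigma_finite_measure set 'rV[R]_n -> \bar R}).

Definition rV_measureS : set 'rV[R]_n.+1 -> \bar R :=
  pushforward (@lebesgue_measure R \x mu)%E (@rV_cons n).

HB.instance Definition _ := Measure.copy rV_measureS
  (measure_function_pushforward__canonical__measure_function_Measure
    (@lebesgue_measure R \x mu)%E (@measurable_rV_cons n)).

Let sf : sigma_finite setT rV_measureS.
Proof.
have /sigma_finiteP[F [FT ndF Foo]] := sigma_finiteT (@lebesgue_measure R).
have /sigma_finiteP[G [GT ndG Goo]] := sigma_finiteT mu.
pose un (x : 'rV[R]_n.+1) : R * 'rV[R]_n :=
  (x ord0 ord0, \row_i x ord0 (lift ord0 i)).
have mun : measurable_fun setT un.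
  apply: measurable_fun_pair; first exact: measurable_coord.
  apply: measurable_rV => i; under eq_fun do rewrite mxE.
  exact: measurable_coord.
have unK z : un (rV_cons z) = z.
  case: z => x y; rewrite /un rV_cons0; congr pair.
  by apply/rowP => i; rewrite mxE rV_consS.
exists (fun k => un @^-1` (F k `*` G k)).
  rewrite -preimage_bigcup (_ : \bigcup_k _ = setT) ?preimage_setT//.
  rewrite -setXTT FT GT; apply/seteqP; split => [[x y] [k _ [Fx Gy]]|].
    by split; exists k.
  move=> [x y] [[k _ Fx] [l _ Gy]]; exists (maxn k l) => //; split.
    by move: Fx; exact/subsetPset/ndF/leq_maxl.
  by move: Gy; exact/subsetPset/ndG/leq_maxr.
move=> k; have [mF Fk] := Foo k; have [mG Gk] := Goo k; split.
  by rewrite -[X in measurable X]setTI; apply: mun => //; exact: measurableX.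
rewrite /rV_measureS /pushforward (_ : _ @^-1` _ = F k `*` G k); last first.
  apply/seteqP; split => z h; first by rewrite -(unK z); exact: h.
  by rewrite -(unK z) in h.
by rewrite product_measure1E// lte_mul_pinfty// ge0_fin_numE.
Qed.

HB.instance Definition _ := Measure_isSigmaFinite.Build _ _ _ rV_measureS sf.
End step.

(* n-dimensional Lebesgue measure on 'rV[R]_n, built as an iterated product;
   lebesgue_rV_box below gives its value on boxes *)
Fixpoint lebesgue_rV n : {sigma_finite_measure set 'rV[R]_n -> \bar R} :=
  match n with
  | 0 => \d_(0 : 'rV[R]_0)
  | k.+1 => rV_measureS (lebesgue_rV k)
  end.

Lemma lebesgue_rV_box n (A : 'I_n -> set R) :
  (forall i, measurable (A i)) ->
  lebesgue_rV n [set x | forall i, A i (x ord0 i)] =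
  (\prod_(i < n) lebesgue_measure (A i))%E.
Proof.
elim: n A => [|n IH] A mA.
  rewrite big_ord0 /= diracE mem_set//= => -[].
  by [].
rewrite big_ord_recl /= /rV_measureS /pushforward.
rewrite (_ : _ @^-1` _ = A ord0 `*`
   [set x : 'rV[R]_n | forall i, A (lift ord0 i) (x ord0 i)]); last first.
  apply/seteqP; split => [[x y] /= h|[x y] /= [h0 h] i].
    split; first by have := h ord0; rewrite rV_cons0.
    by move=> i; have := h (lift ord0 i); rewrite rV_consS.
  by case: (unliftP ord0 i) => [j ->|->]; rewrite ?rV_consS ?rV_cons0.
rewrite product_measure1E.
- by congr (_ * _)%E; exact: (IH (fun i => A (lift ord0 i))).
- exact: mA.
- rewrite (_ : mkset _ = \bigcap_(i in [set: 'I_n])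
      ((fun x : 'rV[R]_n => x ord0 i) @^-1` A (lift ord0 i))); last first.
    by apply/seteqP; split => x /= h i; [move=> _|]; exact: h.
  apply: fin_bigcap_measurable; first exact: finite_finset.
  by move=> i _; rewrite -[X in measurable X]setTI; exact: measurable_coord.
Qed.
End lebesgue_rV.

Section domain.
Context {R : realType} {d : nat}.
Local Notation E := 'rV[R]_d.
Local Notation mu := (lebesgue_rV d).
Implicit Types (Omega : set E) (q : \bar R).

Definition dotv n (v w : 'rV[R]_n) : R := \sum_(i < n) v ord0 i * w ord0 i.

(* the Euclidean norm; the library norm `|v| on 'rV[R]_n is the sup norm *)
Definition enorm n (v : 'rV[R]_n) : R := Num.sqrt (dotv v v).

(* Functions on Omega are represented by functions on the whole space whose
   values outside Omega are irrelevant; elements of L^q are represented by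
   Borel functions, and everything below only depends on their a.e. class. *)
Definition Lq Omega q (f : E -> R) : Prop := f \_ Omega \in Lfun mu q.

Definition Lq_norm Omega q (f : E -> R) : R :=
  fine ('N[mu]_q[EFin \o (f \_ Omega)])%E.

Definition L2 Omega : (E -> R) -> Prop := Lq Omega 2%:E.
Definition L2_norm Omega : (E -> R) -> R := Lq_norm Omega 2%:E.
Definition L2v Omega (v : E -> E) : Prop :=
  forall i, L2 Omega (fun x => v x ord0 i).

Definition inner Omega (f g : E -> R) : R :=
  \int[mu]_(x in Omega) (f x * g x).
Definition innerv Omega (v w : E -> E) : R :=
  \int[mu]_(x in Omega) dotv (v x) (w x).

Definition partial n (i : 'I_n) (f : 'rV[R]_n -> R) (x : 'rV[R]_n) : R :=
  'D_(delta_mx ord0 i) f x.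

Definition gradient (f : E -> R) (x : E) : E := \row_i partial i f x.

Fixpoint Ck n (k : nat) (f : 'rV[R]_n -> R) : Prop :=
  match k with
  | 0%N => continuous f
  | k'.+1 => (forall x, differentiable f x) /\ forall i, Ck k' (partial i f)
  end.

Definition boundary Omega : set E := closure Omega `\` Omega°.

(* near each boundary point, Omega is, up to the choice of one coordinate axis
   and of its orientation, the strict epigraph of a C^2 function of the
   remaining coordinates *)
Definition C2_boundary Omega : Prop :=
  forall x0, boundary Omega x0 ->
  exists (k : 'I_d) (b : bool) (gamma : 'rV[R]_d.-1 -> R), Ck 2 gamma /\
    \forall x \near x0, Omega x <-> gamma (col' k x) < (-1) ^+ b * x ord0 k.

(* bounded domain (nonempty connected open set) with C^2 boundary *)
Definition C2_bounded_domain Omega : Prop :=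
  [/\ Omega !=set0, open Omega, connected Omega, bounded_set Omega
    & C2_boundary Omega].

(* C_c^oo(Omega) *)
Definition test_function Omega (psi : E -> R) : Prop :=
  [/\ forall k, Ck k psi,
      compact (closure [set x | psi x != 0])
    & closure [set x | psi x != 0] `<=` Omega].

(* distributional divergence and gradient on Omega *)
Definition weak_divergence Omega (v : E -> E) (dv : E -> R) : Prop :=
  forall psi, test_function Omega psi ->
    innerv Omega v (gradient psi) = - inner Omega dv psi.

Definition weak_gradient Omega (phi : E -> R) (dphi : E -> E) : Prop :=
  forall psi, test_function Omega psi ->
    forall i, inner Omega phi (partial i psi) =
              - inner Omega (fun x => dphi x ord0 i) psi.

(* the divergence of v in L^2(Omega); unique a.e. when it exists *)
Definition divergence Omega (v : E -> E) : E -> R :=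
  xget (fun=> 0) [set dv | L2 Omega dv /\ weak_divergence Omega v dv].

(* v . nu = 0 on the boundary for v in H(div; Omega), where the normal trace
   v . nu is the functional on (traces of) H^1(Omega) given by Green's formula
     <v . nu, phi> = (v, grad phi) + (div v, phi) *)
Definition zero_normal_trace Omega (v : E -> E) : Prop :=
  forall phi dphi, L2 Omega phi -> L2v Omega dphi ->
    weak_gradient Omega phi dphi ->
    innerv Omega v dphi + inner Omega (divergence Omega v) phi = 0.

Definition Vspace Omega (v : E -> E) : Prop :=
  [/\ L2v Omega v,
      exists dv, L2 Omega dv /\ weak_divergence Omega v dv
    & zero_normal_trace Omega v].

(* phi \in C([0, T]; L^q(Omega)) *)
Definition C0_Lq Omega q (T : R) (phi : R -> E -> R) : Prop :=
  (forall t, t \in `[0, T] -> Lq Omega q (phi t)) /\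
  (forall t, t \in `[0, T] ->
    Lq_norm Omega q (fun x => phi tau x - phi t x)
      @[tau --> within `[0, T] (nbhs t)] --> (0 : R)).

(* phi \in C^1([0, T]; L^q(Omega)) with time derivative phi'; the derivative
   is one-sided at 0 and T *)
Definition C1_Lq Omega q (T : R) (phi phi' : R -> E -> R) : Prop :=
  [/\ C0_Lq Omega q T phi,
      C0_Lq Omega q T phi'
    & forall t, t \in `[0, T] ->
      Lq_norm Omega q
        (fun x => (tau - t)^-1 * (phi tau x - phi t x) - phi' t x)
        @[tau --> within `[0, T] t^'] --> (0 : R)].

(* pt is the time derivative of p *)
Record mixed_solution Omega (K : R -> R) (T : R) (f : R -> E -> R)
    (p0 : E -> R) (p pt : R -> E -> R) (s u : R -> E -> E) : Prop := {
  mixed_p : forall t, t \in `[0, T] -> L2 Omega (p t);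
  mixed_s : forall t, t \in `[0, T] -> L2v Omega (s t);
  mixed_u : forall t, t \in `[0, T] -> Vspace Omega (u t);
  mixed_eq1 : forall t, t \in `]0, T[ -> forall w, L2 Omega w ->
    inner Omega (pt t) w + inner Omega (divergence Omega (u t)) w =
    inner Omega (f t) w;
  mixed_eq2 : forall t, t \in `]0, T[ -> forall z, L2v Omega z ->
    innerv Omega (u t) z
      + innerv Omega (fun x => K (enorm (s t x)) *: s t x) z = 0;
  mixed_eq3 : forall t, t \in `]0, T[ -> forall v, Vspace Omega v ->
    innerv Omega (s t) v + inner Omega (p t) (divergence Omega v) = 0;
  mixed_init : {ae mu, forall x, Omega x -> p 0 x = p0 x} }.

Definition Mfun Omega (beta T : R) (f p : R -> E -> R) (s : R -> E -> E)
    (t : R) : R :=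
  Lq_norm Omega beta%:E (fun x => enorm (s 0 x)) `^ beta
  + L2_norm Omega (p 0) ^+ 2
  + 2 * (\int[lebesgue_measure]_(tau in `[0, t]) (L2_norm Omega (f tau) ^+ 2))
  + t * (L2_norm Omega (p 0)
         + \int[lebesgue_measure]_(tau in `[0, T]) L2_norm Omega (f tau)) ^+ 2.

End domain.

Section forchheimer.
Context {R : realType} {N : nat}.
Variables (a alpha : 'I_N.+1 -> R).

(* powR satisfies 0 `^ 0 = 1, so the term of exponent alpha_0 = 0 is a_0 *)
Definition gfun (s : R) : R := \sum_(i < N.+1) a i * s `^ alpha i.

(* the solution s >= 0 of s * g(s) = xi, unique under forchheimer_data *)
Definition sfun (xi : R) : R := xget 0 [set s | 0 <= s /\ s * gfun s = xi].

Definition Kfun (xi : R) : R := (gfun (sfun xi))^-1.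

Definition forchheimer_data : Prop :=
  [/\ (1 <= N)%N,
      alpha ord0 = 0 /\ (forall i j : 'I_N.+1, (i < j)%N -> alpha i < alpha j),
      forall i, 0 <= a i, 0 < a ord0 & 0 < a ord_max].

Definition aexp : R := alpha ord_max / (alpha ord_max + 1).
Definition betaexp : R := 2 - aexp.

End forchheimer.

(* Main.v *)
Require Import Defs.
From mathcomp Require Import all_boot all_order all_algebra.
From mathcomp Require Import all_classical all_reals all_analysis.
From mathcomp Require Import measurable_realfun ess_sup_inf.
From mathcomp Require Import ring lra.
Set Implicit Arguments.
Unset Strict Implicit.
Unset Printing Implicit Defensive.
Import Order.TTheory GRing.Theory Num.Theory.
Import numFieldNormedType.Exports.
Local Open Scope classical_set_scope.
Local Open Scope ring_scope.

(** The problem is a weak form of p_t - div (K(|grad p|) grad p) = f with no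
flux through the boundary, that is, up to the source term, the gradient flow
of a convex energy.  The proof is the one for gradient flows: an energy
estimate bounds p_t in L^2(0, t; L^2), and monotonicity turns this into a
pointwise bound after a small time.

Convexity enters through a single inequality.  In the variable s(xi) defined
by s g(s) = xi, the map y |-> K(|y|) y has norm s(|y|) and is a subgradient of
a radial function, [potential]; the subgradient inequality [potential_le] is
Young's inequality applied to each monomial of g.  Integrating it over Omega
gives [energy_le], and adding two instances of it gives [flux_monotone].

Time regularity is limited: p is C^1 in time and s only continuous, with
values in L^2, so that the equations cannot be differentiated in time.  All
time derivatives of energies are therefore upper right Dini derivatives,
computed on increments, and [dini_le_integral] integrates them.

Everything about the equations is contained in [test_identity]: testing at
time t with increments between two times t1 and t2,
  (K(|s(t)|) s(t), s(t1) - s(t2)) = (f(t) - p_t(t), p(t1) - p(t2)).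

Energy estimate.  Together with [energy_le] the identity gives
  D^+ energy(s) <= (f - p_t, p_t) <= (|f|^2 - |p_t|^2) / 2,
hence the bound of the integral of |p_t|^2 by 2 energy(s^0) plus the integral
of |f|^2 ([integral_sqr_pt_le]).  Since K(xi) xi^2 = O(xi^beta), the initial
energy is at most a constant times the beta-th power of the L^beta norm of
s^0 ([energy_le_Lbeta]).

Estimate of p_t.  For a lag h, let q be the increment of p over h and r that
of f.  Monotonicity gives d/dt |q|^2 <= 2 (r, q) ([difference_growth]);
dividing by h^2 and letting h tend to 0 yields
  D^+ |p_t|^2 <= 2 |f_t| |p_t| <= |p_t|^2 + |f_t|^2   ([pt_dini]).
Integrate this from t' to t, average over t' in [0, t0] ([sqr_pt_le]), and
bound the integrals of |p_t|^2 over [0, t0] and [0, t] by the energy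
estimate. *)

(** * Dini derivatives and limits on the real line *)

Section dini.
Context {R : realType}.
Implicit Types (F g : R -> R) (a b c : R).

(** With a slope slightly larger than c, F minus the line of that slope is
strictly smaller just to the right of every interior point, so its minimum
over [a', b] with a < a' can only be at b; then a' tends to a. *)
Lemma dini_le F a b c : a <= b -> {within `[a, b], continuous F} ->
  (forall t, a < t < b -> forall e, 0 < e ->
    \forall h \near 0^'+, F (t + h) <= F t + h * (c + e)) ->
  F b - F a <= c * (b - a).
Proof.
rewrite le_eqVlt => /predU1P[->|ab] cF DF; first by rewrite !subrr mulr0.
have main a' : a < a' < b -> F b - F a' <= c * (b - a').
  move=> /andP[aa' a'b]; apply/ler_addgt0Pr => e e0.
  (* The line has slope c + 2 k: one k absorbs the error of the Dini bound,
     the other keeps the decrease strict; 2 k (b - a') = e is the total loss. *)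
  pose k := e / (b - a') / 2.
  have ba0 : 0 < b - a' by rewrite subr_gt0.
  have k0 : 0 < k by rewrite /k !divr_gt0.
  pose G x := F x - (c + 2 * k) * x.
  have cG : {within `[a', b], continuous G}.
    have sub : `[a', b]%classic `<=` `[a, b]%classic.
      by apply: subset_itvr; rewrite bnd_simp ltW.
    move=> x; apply: cvgB; first exact: (continuous_subspaceW sub cF).
    apply: cvgM; first exact: cvg_cst.
    exact: (continuous_subspaceT (fun y => @cvg_id _ (nbhs y))).
  have [m /[!in_itv]/= /andP[a'm mb] mmin] := EVT_min (ltW a'b) cG.
  have [mb'|] := ltP m b; last first.
    move=> bm; have {bm mb} mE : m = b by apply/eqP; rewrite eq_le mb bm.
    have := mmin a'; rewrite in_itv/= lexx (ltW a'b) mE => /(_ isT).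
    rewrite /G.
    have -> : e = 2 * k * (b - a') by rewrite /k; field; rewrite gt_eqF.
    lra.
  have := DF m; rewrite (lt_le_trans aa' a'm) mb' => /(_ isT k k0) Dm.
  near (0 : R)^'+ => h.
  have h0 : 0 < h by near: h; exact: nbhs_right_gt.
  have hb : h < b - m by near: h; apply: nbhs_right_lt; rewrite subr_gt0.
  have Fh : F (m + h) <= F m + h * (c + k) by near: h; exact: Dm.
  have := mmin (m + h); rewrite in_itv/=.
  have -> : a' <= m + h by lra.
  have -> : m + h <= b by lra.
  move=> /(_ isT); rewrite /G.
  have := mulr_gt0 h0 k0.
  nra.
have Fa : F x @[x --> a^'+] --> F a.
  by move/continuous_within_itvP : cF => /(_ ab)[].
have cvg0 : F b - F x - c * (b - x) @[x --> a^'+] --> F b - F a - c * (b - a).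
  apply: cvgB; first by apply: cvgB => //; exact: cvg_cst.
  apply: cvgM; first exact: cvg_cst.
  apply: cvgB; first exact: cvg_cst.
  by apply: cvg_at_right_filter; exact: cvg_id.
rewrite -subr_le0; apply: (cvgr_to_le cvg0).
near=> x; rewrite subr_le0; apply: main; apply/andP; split; near: x.
  exact: nbhs_right_gt.
exact: nbhs_right_lt.
Unshelve. all: by end_near. Qed.


Lemma continuous_itv_integrable g a b : a <= b -> {within `[a, b], continuous g} ->
  lebesgue_measure.-integrable `[a, b] (EFin \o g).
Proof.
move=> ab cg; apply: continuous_compact_integrable => //.
exact: segment_compact.
Qed.

(** Subtracting the primitive of g reduces the claim to the slope 0. *)
Lemma dini_le_integral F g a b : a <= b -> {within `[a, b], continuous F} ->
  {within `[a, b], continuous g} ->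
  (forall t, a < t < b -> forall e, 0 < e ->
    \forall h \near 0^'+, F (t + h) <= F t + h * (g t + e)) ->
  F b - F a <= \int[lebesgue_measure]_(t in `[a, b]) g t.
Proof.
rewrite le_eqVlt => /predU1P[->|ab] cF cg DF.
  by rewrite subrr set_itv1 Rintegral_set1.
have ig := continuous_itv_integrable (ltW ab) cg.
pose A x := \int[lebesgue_measure]_(t in `[a, x]) g t.
have cA : {within `[a, b], continuous A}.
  exact: (parameterized_integral_continuous (ltW ab) ig).
have Aa : A a = 0 by rewrite /A set_itv1 Rintegral_set1.
suff : (F b - A b) - (F a - A a) <= 0 * (b - a) by rewrite Aa -/(A b); lra.
apply: (@dini_le (fun x => F x - A x)); first exact: ltW.
  by move=> x; apply: cvgB; [exact: cF|exact: cA].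
move=> t atb e e0; have /andP[at_ tb] := atb.
have gt : {for t, continuous g}.
  move: cg => /(continuous_within_itvP _ ab)[cg _ _].
  by apply: cg; rewrite in_itv/= at_ tb.
have [dA A't] := continuous_FTC1_closed tb ig at_ gt.
have e20 : 0 < e / 2 by rewrite divr_gt0.
have cvA : h^-1 *: (A (h + t) - A t) @[h --> 0^'+] --> g t.
  apply: cvg_dnbhs_at_right; rewrite -A't.
  have dE : (fun h : R => h^-1 *: ((A \o shift t) (h *: 1) - A t)) =
      (fun h => h^-1 *: (A (h + t) - A t)).
    by apply/funext => h; rewrite /= [_ *: 1]mulr1.
  by move: dA; rewrite /derivable dE.
near=> h.
have h0 : 0 < h by near: h; exact: nbhs_right_gt.
have Fh : F (t + h) <= F t + h * (g t + e / 2) by near: h; exact: DF.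
have : g t - e / 2 <= h^-1 *: (A (h + t) - A t).
  by near: h; apply: (cvgr_ge _ cvA); rewrite ltrBlDr ltrDl.
rewrite [_ *: _]mulrC ler_pdivlMr// (addrC h t).
nra.
Unshelve. all: by end_near. Qed.

End dini.

Section limits.
Context {R : realType}.

Lemma cvg_sumR (I : eqType) (r : seq I) (F : set_system R) {FF : Filter F}
    (h : I -> R -> R) (l : I -> R) :
  (forall i, h i x @[x --> F] --> l i) ->
  \sum_(i <- r) h i x @[x --> F] --> \sum_(i <- r) l i.
Proof.
move=> hl; elim: r => [|i r IH].
  by rewrite big_nil; under eq_fun do rewrite big_nil; exact: cvg_cst.
rewrite big_cons; under eq_fun do rewrite big_cons.
by apply: cvgD; [exact: hl|exact: IH].
Qed.

Lemma right_near_ball (A : R -> Prop) :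
  (\forall k \near (0 : R)^'+, A k) ->
  exists2 e : R, 0 < e & forall k, 0 < k -> k < e -> A k.
Proof.
move=> /nbhs_ballP[e /= e0 eA]; exists e => // k k0 ke.
by apply: eA => //; rewrite /ball/= sub0r normrN gtr0_norm.
Qed.

End limits.

(** * The scalar constitutive law and its potential *)

Section forchheimer_law.
Context {R : realType} {N : nat} (a alpha : 'I_N.+1 -> R).
Hypothesis hg : forchheimer_data a alpha.

Local Notation g := (gfun a alpha).
Local Notation s := (Defs.sfun a alpha).
Local Notation K := (Kfun a alpha).

Lemma alpha_ge0 i : 0 <= alpha i.
Proof.
have [_ [a0 mono] _ _ _] := hg.
have [->|i0] := eqVneq i ord0; first by rewrite a0.
by rewrite -a0 ltW// mono// lt0n.
Qed.

Lemma coef_ge0 i : 0 <= a i. Proof. by have [_ _ /(_ i)] := hg. Qed.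

Lemma coef0_gt0 : 0 < a ord0. Proof. by have [] := hg. Qed.

Lemma gfun_ge_term i x : a i * x `^ alpha i <= g x.
Proof.
rewrite /gfun (bigD1 i)//= lerDl; apply: sumr_ge0 => j _.
by rewrite mulr_ge0 ?coef_ge0 ?powR_ge0.
Qed.

Lemma gfun_ge_coef0 x : a ord0 <= g x.
Proof.
have [_ [a0 _] _ _ _] := hg.
by have := gfun_ge_term ord0 x; rewrite a0 powRr0 mulr1.
Qed.

Lemma gfun_gt0 x : 0 < g x.
Proof. exact: lt_le_trans coef0_gt0 (gfun_ge_coef0 x). Qed.

Lemma gfun_le x y : 0 <= x -> x <= y -> g x <= g y.
Proof.
move=> x0 xy; apply: ler_sum => i _; rewrite ler_wpM2l ?coef_ge0//.
by apply: ge0_ler_powR; rewrite ?alpha_ge0 ?nnegrE// (le_trans x0).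
Qed.

Lemma flux_mono x y : 0 <= x -> x < y -> x * g x < y * g y.
Proof.
move=> x0 xy; apply: (@le_lt_trans _ _ (x * g y)).
  by rewrite ler_wpM2l// gfun_le// ltW.
by rewrite ltr_pM2r// gfun_gt0.
Qed.

Lemma mul_powR (x p : R) : 0 <= x -> 0 <= p -> x * x `^ p = x `^ (p + 1).
Proof.
move=> x0 p0; rewrite powRD ?powRr1 1?mulrC//.
by rewrite gt_eqF// (lt_le_trans ltr01)// lerDr.
Qed.

Lemma flux_sumE x : 0 <= x -> x * g x = \sum_(i < N.+1) a i * x `^ (alpha i + 1).
Proof.
move=> x0; rewrite /gfun mulr_sumr; apply: eq_bigr => i _.
by rewrite mulrCA mul_powR// alpha_ge0.
Qed.

(** Continuity at 0 is seen on the expanded sum, where all exponents are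
positive. *)
Lemma flux_continuous (b : R) : 0 < b ->
  {within `[0, b], continuous (fun x : R => x * g x)}.
Proof.
move=> b0.
have cx (x : R) : 0 < x -> {for x, continuous (fun x : R => x * g x)}.
  move=> x0; apply: cvgM; first exact: cvg_id.
  apply: cvg_sumR => i; apply: cvgM; first exact: cvg_cst.
  suff : {for x, continuous (fun y : R => y `^ alpha i)} by [].
  apply: differentiable_continuous; apply/derivable1_diffP.
  by apply: derivable_powR; rewrite in_itv/= x0.
apply/continuous_within_itvP => //; split.
- by move=> x; rewrite in_itv/= => /andP[x0 _]; exact: cx.
- rewrite mul0r.
  have c0 : \sum_(i < N.+1) a i * x `^ (alpha i + 1) @[x --> 0^'+] -->
     \sum_(i < N.+1) a i * 0.
    apply: cvg_sumR => i; apply: cvgM; first exact: cvg_cst.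
    by apply: powR_cvg0; rewrite ltr_wpDl// alpha_ge0.
  move: c0; rewrite big1; last by move=> i _; rewrite mulr0.
  apply: cvg_trans; apply: near_eq_cvg; near=> x.
  by rewrite flux_sumE.
- by apply: cvg_at_left_filter; exact: cx.
Unshelve. all: by end_near. Qed.

Lemma sfunP xi : 0 <= xi -> 0 <= s xi /\ s xi * g (s xi) = xi.
Proof.
move=> xi0; suff : [set x | 0 <= x /\ x * g x = xi] (s xi) by [].
(* As g >= a_0, the value of x g(x) at this point is at least xi. *)
pose b := xi / a ord0 + 1.
have b0 : 0 < b by rewrite ltr_wpDl// divr_ge0// ltW// coef0_gt0.
have fb : xi <= b * g b.
  apply: (@le_trans _ _ (b * a ord0)); last first.
    by rewrite ler_wpM2l ?gfun_ge_coef0// ltW.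
  rewrite mulrDl divfK ?mul1r ?lerDl ?(ltW coef0_gt0)// gt_eqF//.
  exact: coef0_gt0.
have fbE : Num.min (0 * g 0) (b * g b) <= xi <= Num.max (0 * g 0) (b * g b).
  have fb0 := le_trans xi0 fb.
  by rewrite mul0r (min_idPl fb0) (max_idPr fb0) xi0.
have [c] := @IVT _ (fun x : R => x * g x) 0 b xi (ltW b0) (flux_continuous b0) fbE.
rewrite in_itv/= => /andP[c0 _] cE.
have ex : exists x, [set x | 0 <= x /\ x * g x = xi] x by exists c.
by rewrite /Defs.sfun; exact: xgetPex ex.
Qed.

Lemma sfun_ge0 xi : 0 <= s xi.
Proof.
have [/sfunP[]//|xi0] := leP 0 xi.
rewrite /Defs.sfun xgetPN// => x [x0 xE]; move: xi0; rewrite -xE.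
by rewrite ltNge mulr_ge0// ltW// gfun_gt0.
Qed.

Lemma sfun_nneg_le0 xi : xi <= 0 -> s xi = 0.
Proof.
rewrite le_eqVlt => /predU1P[->|xi0].
  have [s0 /eqP] := sfunP (lexx 0).
  by rewrite mulf_eq0 (gt_eqF (gfun_gt0 _)) orbF => /eqP.
rewrite /Defs.sfun xgetPN// => x [x0 xE]; move: xi0; rewrite -xE.
by rewrite ltNge mulr_ge0// ltW// gfun_gt0.
Qed.

Lemma sfun_nondecreasing : nondecreasing_fun s.
Proof.
move=> x y xy; have [x0|/ltW/sfun_nneg_le0 ->] := leP 0 x; last exact: sfun_ge0.
have [sx0 sxE] := sfunP x0.
have [sy0 syE] := sfunP (le_trans x0 xy).
rewrite leNgt; apply/negP => /(flux_mono sy0).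
by rewrite sxE syE ltNge xy.
Qed.

Lemma Kfun_ge0 xi : 0 <= K xi.
Proof. by rewrite invr_ge0 ltW// gfun_gt0. Qed.

Lemma Kfun_le xi : K xi <= (a ord0)^-1.
Proof. by rewrite lef_pV2 ?posrE ?gfun_gt0 ?coef0_gt0// gfun_ge_coef0. Qed.

Lemma Kfun_mul xi : 0 <= xi -> K xi * xi = s xi.
Proof.
move=> /sfunP[_ E]; rewrite -[X in K _ * X]E mulrCA /Kfun mulVf ?mulr1//.
by rewrite gt_eqF// gfun_gt0.
Qed.

Lemma measurable_sfun : measurable_fun setT s.
Proof. by apply: nondecreasing_measurable => //; exact: sfun_nondecreasing. Qed.

Lemma measurable_Kfun : measurable_fun setT K.
Proof.
apply: nonincreasing_measurable => // x y xy.
rewrite lef_pV2 ?posrE ?gfun_gt0// gfun_le ?sfun_ge0//.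
exact: sfun_nondecreasing.
Qed.

(** This is the integral of K(r) r = s(r) over [0, xi], evaluated through the
substitution r = s g(s). *)
Definition potential xi :=
  \sum_(i < N.+1) a i * ((1 - (alpha i + 2)^-1) * s xi `^ (alpha i + 2)).

Lemma measurable_potential : measurable_fun setT potential.
Proof.
apply: measurable_sum => i; do 2 (apply: measurable_funM => //).
exact: (measurableT_comp (measurable_powR _) measurable_sfun).
Qed.

Lemma potential_ge0 xi : 0 <= potential xi.
Proof.
apply: sumr_ge0 => i _; rewrite mulr_ge0 ?coef_ge0// mulr_ge0 ?powR_ge0//.
have := alpha_ge0 i => ai.
by rewrite subr_ge0 invf_le1; lra.
Qed.

(** The convexity of [potential], whose derivative is s.  After expanding
y = s(y) g(s(y)) and x likewise, it holds monomial by monomial: with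
q = alpha_i + 2 it is Young's inequality
s(y) s(x)^(q-1) <= s(y)^q / q + (1 - 1/q) s(x)^q. *)
Lemma potential_le x y : 0 <= x -> 0 <= y ->
  potential y - potential x <= s y * (y - x).
Proof.
move=> x0 y0; have [sx0 xE] := sfunP x0; have [sy0 yE] := sfunP y0.
rewrite -[X in _ * (X - _)]yE -[X in _ * (_ - X)]xE.
rewrite !flux_sumE// -!sumrB mulr_sumr; apply: ler_sum => i _.
rewrite -!mulrBr [leRHS]mulrCA ler_wpM2l ?coef_ge0//.
have ai := alpha_ge0 i.
set q := alpha i + 2; have q0 : 0 < q by rewrite /q; lra.
have young := @conjugate_powR R (s y) (s x `^ (alpha i + 1)) q (1 - q^-1)^-1
  sy0 (powR_ge0 _ _) q0.
have q1 : q^-1 < 1 by rewrite invf_lt1 /q //; lra.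
have {young} := young _ _; rewrite invr_gt0 subr_gt0 q1 => /(_ isT).
rewrite invrK addrC subrK => /(_ erefl).
have -> : (s x `^ (alpha i + 1)) `^ (1 - q^-1)^-1 = s x `^ q.
  rewrite -powRrM; congr (_ `^ _); rewrite /q; field; lra.
have -> : s y * (s y `^ (alpha i + 1) - s x `^ (alpha i + 1)) =
    s y `^ q - s y * s x `^ (alpha i + 1).
  by rewrite mulrBr mul_powR ?addr_ge0// /q; congr (_ `^ _ - _); ring.
lra.
Qed.

Lemma potential0 : potential 0 = 0.
Proof.
rewrite /potential big1// => i _; rewrite sfun_nneg_le0// powR0 ?mulr0//.
by have ai := alpha_ge0 i; rewrite gt_eqF//; lra.
Qed.

Lemma potential_le_mul x : 0 <= x -> potential x <= s x * x.
Proof.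
move=> x0; have := potential_le (lexx 0) x0.
by rewrite potential0 !subr0.
Qed.

Lemma betaexp_gt1 : 1 < betaexp alpha.
Proof.
have := alpha_ge0 ord_max => ai; rewrite /betaexp /aexp.
suff : alpha ord_max / (alpha ord_max + 1) < 1 by lra.
by rewrite ltr_pdivrMr; lra.
Qed.

Lemma betaexp_le2 : betaexp alpha <= 2.
Proof.
have := alpha_ge0 ord_max => ai; rewrite /betaexp /aexp.
by rewrite gerBl divr_ge0//; lra.
Qed.

(** From x = s g(s) >= a_N s^(alpha_N + 1), where 1 / (alpha_N + 1) is
beta - 1. *)
Lemma sfun_growth x : 0 <= x ->
  s x * x <= ((a ord_max)^-1) `^ (betaexp alpha - 1) * x `^ betaexp alpha.
Proof.
move=> x0; have [sx0 xE] := sfunP x0.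
have aN : 0 < a ord_max by have [] := hg.
have ai := alpha_ge0 ord_max; set al := alpha ord_max in ai *.
have bE : betaexp alpha - 1 = (al + 1)^-1.
  by rewrite /betaexp /aexp -/al; field; lra.
have sx : s x `^ (al + 1) <= (a ord_max)^-1 * x.
  rewrite ler_pdivlMl// -[leRHS]xE -mul_powR// mulrCA ler_wpM2l//.
  exact: gfun_ge_term.
have {}sx : s x <= ((a ord_max)^-1 * x) `^ (betaexp alpha - 1).
  have -> : s x = (s x `^ (al + 1)) `^ (betaexp alpha - 1).
    by rewrite -powRrM bE mulfV ?powRr1//; lra.
  apply: ge0_ler_powR; rewrite ?nnegrE ?powR_ge0 ?mulr_ge0 ?invr_ge0 ?(ltW aN)//.
  by rewrite bE invr_ge0; lra.
rewrite (le_trans (ler_wpM2r x0 sx))// powRM ?invr_ge0 ?(ltW aN)//.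
rewrite -mulrA ler_wpM2l ?powR_ge0// mulrC mul_powR ?subrK//.
by have := betaexp_gt1; lra.
Qed.

End forchheimer_law.

(** * The pre-Hilbert structure of square integrable functions *)

(** The discriminant argument, shared by the Euclidean product and the product
of L^2. *)
Lemma cauchy_schwarz_of_quadratic {R : realType} (A B C : R) : 0 <= A -> 0 <= C ->
  (forall l, 0 <= A + 2 * l * B + l ^+ 2 * C) ->
  B <= Num.sqrt A * Num.sqrt C.
Proof.
move=> A0 C0 q.
have [B0|B0] := leP B 0; first by rewrite (le_trans B0)// mulr_ge0// sqrtr_ge0.
have sqB : B ^+ 2 <= A * C.
  (* For C = 0 the quadratic is affine with nonzero slope and takes the value
     -1; for C > 0 it is evaluated at its minimum. *)
  move: C0; rewrite le_eqVlt => /predU1P[C0|C0].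
    have := q (- (A + 1) / (2 * B)); rewrite -C0 mulr0 addr0.
    have -> : 2 * (- (A + 1) / (2 * B)) * B = - (A + 1).
      by field; rewrite gt_eqF.
    lra.
  have := q (- B / C).
  have -> : A + 2 * (- B / C) * B + (- B / C) ^+ 2 * C = (A * C - B ^+ 2) / C.
    by field; rewrite gt_eqF.
  by rewrite pmulr_lge0 ?invr_gt0// subr_ge0.
rewrite -sqrtrM// -[leLHS](ger0_norm (ltW B0)) -sqrtr_sqr.
by rewrite ler_sqrt// (le_trans _ sqB)// sqr_ge0.
Qed.

Section euclidean.
Context {R : realType} {n : nat}.
Implicit Types v w : 'rV[R]_n.

Lemma dotvC v w : dotv v w = dotv w v.
Proof. by apply: eq_bigr => i _; rewrite mulrC. Qed.

Lemma dotvZl (c : R) v w : dotv (c *: v) w = c * dotv v w.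
Proof. by rewrite /dotv mulr_sumr; apply: eq_bigr => i _; rewrite mxE mulrA. Qed.

Lemma dotvBr u v w : dotv u (v - w) = dotv u v - dotv u w.
Proof. by rewrite /dotv -sumrB; apply: eq_bigr => i _; rewrite !mxE mulrBr. Qed.

Lemma dotvv_ge0 v : 0 <= dotv v v.
Proof. by apply: sumr_ge0 => i _; rewrite -expr2 sqr_ge0. Qed.

Lemma sqr_enorm v : enorm v ^+ 2 = dotv v v.
Proof. by rewrite sqr_sqrtr// dotvv_ge0. Qed.

Lemma enorm_ge0 v : 0 <= enorm v. Proof. exact: sqrtr_ge0. Qed.

Lemma enormN v : enorm (- v) = enorm v.
Proof.
by congr Num.sqrt; apply: eq_bigr => i _; rewrite !mxE mulrNN.
Qed.

Lemma dotv_le v w : dotv v w <= enorm v * enorm w.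
Proof.
apply: cauchy_schwarz_of_quadratic; rewrite ?dotvv_ge0// => l.
rewrite (_ : _ + _ = dotv (v + l *: w) (v + l *: w)) ?dotvv_ge0//.
rewrite /dotv !mulr_sumr -!big_split/=; apply: eq_bigr => i _.
by rewrite !mxE; ring.
Qed.

Lemma coord_le_enorm v i : `|v ord0 i| <= enorm v.
Proof.
rewrite -sqrtr_sqr ler_sqrt ?dotvv_ge0// /dotv (bigD1 i)//= -expr2 lerDl.
by apply: sumr_ge0 => j _; rewrite -expr2 sqr_ge0.
Qed.
End euclidean.

Section L2.
Context {R : realType} {d : nat} (Omega : set 'rV[R]_d).
Local Notation mu := (lebesgue_rV d).
Local Notation E := 'rV[R]_d.
Implicit Types (f g h : E -> R) (v w : E -> E).

Local Notation L2 := (@L2 R d Omega).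
Local Notation L2v := (@L2v R d Omega).
Local Notation L2_norm := (@L2_norm R d Omega).
Local Notation inner := (@inner R d Omega).
Local Notation innerv := (@innerv R d Omega).

Lemma restrictM f g : (fun x => f x * g x) \_ Omega = (f \_ Omega) \* (g \_ Omega).
Proof. by apply/funext => x; rewrite /= !patchE; case: ifP; rewrite ?mul0r. Qed.

Lemma restrict_comp (phi : R -> R) f : phi 0 = 0 ->
  (phi \o f) \_ Omega = phi \o (f \_ Omega).
Proof. by move=> phi0; apply/funext => x; rewrite /= !patchE; case: ifP. Qed.

(** Stated for the extension by zero, in agreement with the definition of L^q
on Omega. *)
Definition integrable_on f := mu.-integrable setT (EFin \o f \_ Omega).

Lemma integrable_onB f g : integrable_on f -> integrable_on g ->
  integrable_on (fun x => f x - g x).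
Proof.
move=> fi gi; have := integrableB measurableT fi gi.
apply: eq_integrable => [|x _]; first exact: measurableT.
by rewrite /= !patchE; case: ifP => // _; rewrite -EFinB subrr.
Qed.

Lemma Rintegral_onB f g : integrable_on f -> integrable_on g ->
  \int[mu]_(x in Omega) (f x - g x) =
  \int[mu]_(x in Omega) f x - \int[mu]_(x in Omega) g x.
Proof.
move=> fi gi; rewrite 3!(Rintegral_mkcond _ Omega).
rewrite -RintegralB; [|exact: measurableT|exact: fi|exact: gi].
apply: eq_Rintegral => x _; rewrite !patchE; case: ifP => // _.
by rewrite subrr.
Qed.

Lemma le_Rintegral_on f g : integrable_on f -> integrable_on g ->
  (forall x, Omega x -> f x <= g x) ->
  \int[mu]_(x in Omega) f x <= \int[mu]_(x in Omega) g x.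
Proof.
move=> fi gi fg; rewrite 2!(Rintegral_mkcond _ Omega).
apply: le_Rintegral; [exact: measurableT|exact: fi|exact: gi|move=> x _].
by rewrite !patchE; case: ifPn => // /set_mem; exact: fg.
Qed.

Lemma L2_measurable f : L2 f -> measurable_fun setT (f \_ Omega).
Proof. by move=> /andP[+ _]; rewrite inE. Qed.

Lemma integrable_mul f g : L2 f -> L2 g ->
  integrable_on (fun x => f x * g x).
Proof.
by move=> f2 g2; rewrite /integrable_on restrictM; apply/Lfun1_integrable/Lfun2_mul_Lfun1.
Qed.

Lemma L2_of_integrable_sqr f : measurable_fun setT (f \_ Omega) ->
  integrable_on (fun x => f x ^+ 2) -> L2 f.
Proof.
move=> mf /integrableP[_ foo]; apply/andP; split; first by rewrite inE.
rewrite inE /= /finite_norm unlock; apply: poweR_lty.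
apply: le_lt_trans foo; rewrite le_eqVlt; apply/orP; left; apply/eqP.
apply: eq_integral => x _ /=; rewrite powR_mulrn// !patchE.
by case: ifP => _; rewrite ?normrX// normr0 expr0n.
Qed.

(** Used for the components of the flux, which are dominated by a multiple of
the Euclidean norm of the field. *)
Lemma L2_dominated f h : measurable_fun setT (h \_ Omega) ->
  (forall x, Omega x -> `|h x| <= f x) -> L2 f -> L2 h.
Proof.
move=> mh hf f2; apply: L2_of_integrable_sqr => //.
apply: (le_integrable measurableT _ _ (integrable_mul f2 f2)).
  apply/measurable_EFinP; have -> : (fun x => h x ^+ 2) \_ Omega =
      (fun x => (h \_ Omega) x ^+ 2).
    by apply: (restrict_comp (phi := fun y => y ^+ 2)); rewrite expr0n.
  exact: measurable_funX.
move=> x _ /=; rewrite lee_fin !patchE; case: ifPn => // /set_mem /hf hx.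
by rewrite normrX normrM -expr2 ler_pXn2r ?nnegrE// (le_trans hx)// ler_norm.
Qed.

Lemma Lq_lin q (c : R) f g : (1 <= q)%E -> Lq Omega q f -> Lq Omega q g ->
  Lq Omega q (fun x => c * f x + g x).
Proof.
move=> q1 fq gq; rewrite /Lq.
have -> : (fun x => c * f x + g x) \_ Omega = c *: (f \_ Omega) + (g \_ Omega).
  apply/funext => x; rewrite -[RHS]/(c * (f \_ Omega) x + (g \_ Omega) x) !patchE.
  by case: ifP; rewrite ?mulr0 ?addr0.
by have [_] := Lfun_submod_closed mu q1; apply.
Qed.

Lemma L2_lin (c : R) f g : L2 f -> L2 g -> L2 (fun x => c * f x + g x).
Proof. by apply: Lq_lin; rewrite lee_fin ler1n. Qed.

Lemma L2_cst0 : L2 (fun=> 0).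
Proof.
have p1 : (1 <= 2%:E :> \bar R)%E by rewrite lee_fin ler1n.
rewrite /Defs.L2 /Lq.
have [] := Lfun_submod_closed mu p1.
by rewrite (_ : (fun=> 0) \_ Omega = 0)//; apply/funext => x; rewrite patchE if_same.
Qed.

Lemma L2D f g : L2 f -> L2 g -> L2 (fun x => f x + g x).
Proof. by move=> f2 g2; have := L2_lin 1 f2 g2; under eq_fun do rewrite mul1r. Qed.

Lemma L2Z (c : R) f : L2 f -> L2 (fun x => c * f x).
Proof. by move=> f2; have := L2_lin c f2 L2_cst0; under eq_fun do rewrite addr0. Qed.

Lemma L2B f g : L2 f -> L2 g -> L2 (fun x => f x - g x).
Proof.
move=> f2 g2; have := L2_lin (-1) g2 f2.
by under eq_fun do rewrite mulN1r addrC.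
Qed.

Lemma L2vB v w : L2v v -> L2v w -> L2v (fun x => v x - w x).
Proof.
move=> v2 w2 i; have := L2B (v2 i) (w2 i).
by under [X in _ -> _ X]eq_fun do rewrite !mxE.
Qed.

Lemma innerC f g : inner f g = inner g f.
Proof. by rewrite /inner; under eq_Rintegral do rewrite mulrC. Qed.

Lemma inner_linl (c : R) f g h : L2 f -> L2 g -> L2 h ->
  inner (fun x => c * f x + g x) h = c * inner f h + inner g h.
Proof.
move=> f2 g2 h2; rewrite /Defs.inner !(Rintegral_mkcond _ Omega).
rewrite -RintegralZl//; last exact: integrable_mul.
rewrite -RintegralD//.
- apply: eq_Rintegral => x _; rewrite !patchE; case: ifP => _; last by rewrite mulr0 addr0.
  by rewrite mulrDl mulrA.
- by have := integrable_mul (L2Z c f2) h2; congr (_.-integrable _ _);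
    apply/funext => x /=; rewrite !patchE; case: ifP; rewrite ?mulr0// mulrA.
- exact: integrable_mul.
Qed.

Lemma innerBl f g h : L2 f -> L2 g -> L2 h ->
  inner (fun x => f x - g x) h = inner f h - inner g h.
Proof.
move=> f2 g2 h2; have := inner_linl (-1) g2 f2 h2; rewrite mulN1r addrC => <-.
by congr inner; apply/funext => x; rewrite mulN1r addrC.
Qed.

Lemma innerDl f g h : L2 f -> L2 g -> L2 h ->
  inner (fun x => f x + g x) h = inner f h + inner g h.
Proof.
move=> f2 g2 h2; have := inner_linl 1 f2 g2 h2; rewrite mul1r => <-.
by congr inner; apply/funext => x; rewrite mul1r.
Qed.

Lemma innerZl (c : R) f h : L2 f -> L2 h ->
  inner (fun x => c * f x) h = c * inner f h.
Proof.
move=> f2 h2.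
have i0 : inner (fun=> 0) h = 0.
  by rewrite /Defs.inner; under eq_Rintegral do rewrite mul0r; rewrite /Rintegral integral0.
have := inner_linl c f2 L2_cst0 h2; rewrite i0 addr0 => <-.
by congr inner; apply/funext => x; rewrite addr0.
Qed.

Lemma innerff_ge0 f : 0 <= inner f f.
Proof. by apply: Rintegral_ge0 => x _; rewrite -expr2 sqr_ge0. Qed.

Lemma L2_norm_ge0 f : 0 <= L2_norm f.
Proof. by rewrite fine_ge0// Lnorm_ge0. Qed.

Lemma sqr_L2_norm f : L2 f -> L2_norm f ^+ 2 = inner f f.
Proof.
move=> f2.
have fN : (L2_norm f)%:E = ('N[mu]_2%:E[EFin \o (f \_ Omega)])%E.
  rewrite fineK// ge0_fin_numE ?Lnorm_ge0//.
  by move: f2 => /andP[_]; rewrite inE.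
have := powR_Lnorm mu (EFin \o (f \_ Omega)) (r := 2).
rewrite pnatr_eq0 => /(_ isT); rewrite -fN -powR_mulrn ?L2_norm_ge0// => N2.
rewrite /Defs.inner Rintegral_mkcond /Rintegral -[LHS]/(fine (_ `^ _)%:E).
rewrite -poweR_EFin N2.
congr fine; apply: eq_integral => x _ /=.
rewrite powR_mulrn// -normrX !patchE; case: ifP => _; last by rewrite expr0n/= normr0.
by rewrite ger0_norm ?sqr_ge0// expr2.
Qed.

Lemma L2_normE f : L2 f -> L2_norm f = Num.sqrt (inner f f).
Proof. by move=> /sqr_L2_norm <-; rewrite sqrtr_sqr ger0_norm ?L2_norm_ge0. Qed.

Lemma inner_le f g : L2 f -> L2 g -> inner f g <= L2_norm f * L2_norm g.
Proof.
move=> f2 g2; rewrite !L2_normE//; apply: cauchy_schwarz_of_quadratic.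
- exact: innerff_ge0.
- exact: innerff_ge0.
move=> l; have lg := L2_lin l g2 f2.
have := innerff_ge0 (fun x => l * g x + f x).
rewrite inner_linl// (innerC g) (innerC f) !inner_linl// (innerC g f).
set A := inner f f; set B := inner f g; set C := inner g g.
by congr (_ <= _); ring.
Qed.

Lemma L2_normZ (c : R) f : L2 f -> L2_norm (fun x => c * f x) = `|c| * L2_norm f.
Proof.
move=> f2; rewrite !L2_normE//; last exact: L2Z.
rewrite innerZl//; last exact: L2Z.
by rewrite innerC innerZl// mulrA -expr2 sqrtrM ?sqr_ge0// sqrtr_sqr.
Qed.

Lemma normr_inner_le f g : L2 f -> L2 g -> `|inner f g| <= L2_norm f * L2_norm g.
Proof.
move=> f2 g2; rewrite ler_norml inner_le// andbT lerNl.
have := inner_le (L2Z (-1) f2) g2.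
by rewrite innerZl// L2_normZ// normrN1 mul1r mulN1r.
Qed.

Lemma ler_L2_normD f g : L2 f -> L2 g ->
  L2_norm (fun x => f x + g x) <= L2_norm f + L2_norm g.
Proof.
move=> f2 g2; rewrite -(@ler_pXn2r _ 2)// ?nnegrE ?addr_ge0 ?L2_norm_ge0//.
have fg := L2D f2 g2.
rewrite sqr_L2_norm// innerDl// !(innerC _ (fun x => f x + g x)) !innerDl//.
rewrite (innerC g f) -!sqr_L2_norm//.
have := inner_le f2 g2; lra.
Qed.

Lemma L2_norm_distC f g : L2 f -> L2 g ->
  L2_norm (fun x => f x - g x) = L2_norm (fun x => g x - f x).
Proof.
move=> f2 g2; rewrite -[RHS]mul1r -normrN1 -L2_normZ; last exact: L2B.
by congr L2_norm; apply/funext => x; rewrite mulN1r opprB.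
Qed.

Lemma ler_L2_dist f g : L2 f -> L2 g ->
  `|L2_norm f - L2_norm g| <= L2_norm (fun x => f x - g x).
Proof.
move=> f2 g2.
have key f' g' : L2 f' -> L2 g' ->
    L2_norm f' <= L2_norm (fun x => f' x - g' x) + L2_norm g'.
  move=> f2' g2'; have := ler_L2_normD (L2B f2' g2') g2'.
  by under [in X in X <= _ -> _]eq_fun do rewrite subrK.
rewrite ler_norml lerBlDr key// andbT.
have := key _ _ g2 f2; rewrite L2_norm_distC//; lra.
Qed.

Lemma integrable_dotv v w : L2v v -> L2v w ->
  integrable_on (fun x => dotv (v x) (w x)) /\
  innerv v w = \sum_(i < d) inner (fun x => v x ord0 i) (fun x => w x ord0 i).
Proof.
move=> v2 w2.
have iI (r : seq 'I_d) : mu.-integrable setT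
    (EFin \o (fun x => \sum_(i <- r) v x ord0 i * w x ord0 i) \_ Omega) /\
    \int[mu]_(x in Omega) (\sum_(i <- r) v x ord0 i * w x ord0 i) =
    \sum_(i <- r) inner (fun x => v x ord0 i) (fun x => w x ord0 i).
  elim: r => [|i r [IH1 IH2]].
    split; last first.
      rewrite big_nil; under eq_Rintegral do rewrite big_nil.
      by rewrite /Rintegral integral0.
    rewrite (_ : EFin \o _ = cst 0%E); first exact: integrable0.
    by apply/funext => x /=; rewrite patchE big_nil if_same.
  have cE : (fun x => \sum_(j <- i :: r) v x ord0 j * w x ord0 j) \_ Omega =
      (fun x => v x ord0 i * w x ord0 i) \_ Omega \+
      (fun x => \sum_(j <- r) v x ord0 j * w x ord0 j) \_ Omega.
    apply/funext => x /=; rewrite !patchE big_cons; case: ifP => //.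
    by rewrite addr0.
  have vw := integrable_mul (v2 i) (w2 i).
  split; first by rewrite cE; exact: (integrableD measurableT vw IH1).
  rewrite Rintegral_mkcond cE RintegralD// -!Rintegral_mkcond IH2 big_cons.
  by [].
exact: iI (index_enum 'I_d).
Qed.

Lemma innervE v w : L2v v -> L2v w ->
  innerv v w = \sum_(i < d) inner (fun x => v x ord0 i) (fun x => w x ord0 i).
Proof. by move=> v2 w2; have [_] := integrable_dotv v2 w2. Qed.

Lemma innerv_Bl u v w : L2v u -> L2v v -> L2v w ->
  innerv (fun x => u x - v x) w = innerv u w - innerv v w.
Proof.
move=> u2 v2 w2; rewrite !innervE//; last exact: L2vB.
rewrite -sumrB; apply: eq_bigr => i _.
rewrite -innerBl//; congr inner; by apply/funext => x; rewrite !mxE.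
Qed.

End L2.

(** * Bounded domains: from essentially bounded to square integrable *)

Section bounded_domain.
Context {R : realType} {d : nat} (Omega : set 'rV[R]_d).
Hypothesis bOmega : bounded_set Omega.
Local Notation mu := (lebesgue_rV d).
Local Notation E := 'rV[R]_d.
Local Notation L2 := (@L2 R d Omega).
Local Notation L2_norm := (@L2_norm R d Omega).

(** A cube that contains Omega, whose measure is the product of its sides. *)
Lemma bounded_sub_finite_measure :
  exists B : set E, [/\ measurable B, Omega `<=` B & (mu B < +oo)%E].
Proof.
have [M [_ OM]] := bOmega.
have {}OM : forall x, Omega x -> `|x| <= M + 1 by apply: OM; rewrite ltrDl.
pose A (i : 'I_d) : set R := `[- (M + 1), M + 1]%classic.
exists [set x : E | forall i, A i (x ord0 i)]; split.
- rewrite (_ : mkset _ = \bigcap_(i in [set: 'I_d])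
      ((fun x : E => x ord0 i) @^-1` A i)); last first.
    by apply/seteqP; split => x /= h i; [move=> _|]; exact: h.
  apply: fin_bigcap_measurable; first exact: finite_finset.
  move=> i _; rewrite -[X in measurable X]setTI.
  by apply: measurable_coord => //; exact: measurable_itv.
- move=> x Ox i; have xM := OM x Ox; rewrite /A /= in_itv/= -ler_norml (le_trans _ xM)//.
  rewrite /Num.norm/= mx_normrE; exact: (le_bigmax _ _ (ord0, i)).
rewrite lebesgue_rV_box//; last by move=> i; rewrite /A.
rewrite ltey_eq prode_fin_num// => i _.
by rewrite /A lebesgue_measure_itv/=; case: ifP.
Qed.

(** The constant is the square root of the volume of a set of finite measure
that contains Omega. *)
Lemma Linfty_L2 : exists2 c, 0 <= c &
  forall f, Lq Omega +oo%E f -> L2 f /\ L2_norm f <= c * Lq_norm Omega +oo%E f.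
Proof.
have [B [mB OB Boo]] := bounded_sub_finite_measure.
exists (Num.sqrt (fine (mu B))) => [|f]; first exact: sqrtr_ge0.
move=> /andP[]; rewrite inE/= => mf; rewrite inE/= /finite_norm => foo.
set M := Lq_norm Omega +oo%E f.
have ME : ('N[mu]_+oo[EFin \o (f \_ Omega)] = M%:E)%E.
  by rewrite /M fineK// ge0_fin_numE ?Lnorm_ge0.
have M0 : 0 <= M by rewrite -lee_fin -ME Lnorm_ge0.
have fM : {ae mu, forall x, (`|(f \_ Omega) x|%:E <= M%:E)%E}.
  move: ME; rewrite unlock; case: ifPn => mu0 ME.
    by have := ess_sup_ge mu (abse \o (EFin \o (f \_ Omega))); rewrite ME.
  exists setT; split => //.
  by apply/eqP; rewrite eq_le measure_ge0 andbT leNgt.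
have mf2 : measurable_fun setT ((fun x => f x ^+ 2) \_ Omega).
  rewrite (@restrict_comp R d Omega (fun y => y ^+ 2) f) ?expr0n//.
  exact: measurable_funX.
have int_le : (\int[mu]_x (((fun x => f x ^+ 2) \_ Omega) x)%:E <=
    (M ^+ 2 * fine (mu B))%:E)%E.
  apply: (@le_trans _ _ (\int[mu]_x (M ^+ 2 * \1_B x)%:E)%E).
    apply: ae_ge0_le_integral => //.
    - by move=> x _; rewrite lee_fin patchE; case: ifP => // _; exact: sqr_ge0.
    - exact/measurable_EFinP.
    - by move=> x _; rewrite lee_fin mulr_ge0// sqr_ge0.
    - by apply/measurable_EFinP; exact: measurable_funM.
    move: fM; apply: filterS => x + _; rewrite !lee_fin !patchE.
    case: ifPn => [/set_mem Ox|_ _]; last by rewrite mulr_ge0// sqr_ge0.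
    rewrite indicE (mem_set (OB x Ox)) mulr1 => fxM.
    by rewrite -real_normK ?num_real// ler_pXn2r ?nnegrE.
  under eq_integral do rewrite EFinM.
  rewrite ge0_integralZl//; last 2 first.
  - by apply/measurable_EFinP.
  - by rewrite lee_fin sqr_ge0.
  by rewrite integral_indic// setIT [leRHS]EFinM (@fineK _ (mu B))// ge0_fin_numE.
have f2 : L2 f.
  apply: L2_of_integrable_sqr => //.
  apply/integrableP; split; first exact/measurable_EFinP.
  apply: (@le_lt_trans _ _ (M ^+ 2 * fine (mu B))%:E); last exact: ltry.
  refine (le_trans _ int_le).
  apply: ge0_le_integral => //.
  - by apply: measurableT_comp => //; exact/measurable_EFinP.
  - exact/measurable_EFinP.
  move=> x _ /=; rewrite lee_fin ger0_norm// patchE.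
  by case: ifP => // _; exact: sqr_ge0.
split => //.
rewrite -(@ler_pXn2r _ 2)// ?nnegrE ?L2_norm_ge0 ?mulr_ge0 ?sqrtr_ge0//.
rewrite exprMn sqr_sqrtr ?fine_ge0// mulrC sqr_L2_norm// -lee_fin.
apply: le_trans int_le; rewrite /inner Rintegral_mkcond /Rintegral fineK.
  by [].
have := integrable_mul f2 f2.
exact: integrable_fin_num.
Qed.

Lemma C1_Linfty_L2 T phi phi' :
  C1_Lq Omega +oo%E T phi phi' -> C1_Lq Omega 2%:E T phi phi'.
Proof.
have [c c0 cP] := Linfty_L2.
have p1 : (1 <= +oo :> \bar R)%E by rewrite leey.
have LB f g : Lq Omega +oo%E f -> Lq Omega +oo%E g ->
    Lq Omega +oo%E (fun x => f x - g x).
  move=> fL gL; have := Lq_lin (-1) p1 gL fL.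
  by under eq_fun do rewrite mulN1r addrC.
have LZ b f : Lq Omega +oo%E f -> Lq Omega +oo%E (fun x => b * f x).
  move=> fL; have := Lq_lin b p1 fL (LB _ _ fL fL).
  by under eq_fun do rewrite subrr addr0.
have cvgL (F : set_system R) (FF : Filter F) (g : R -> E -> R) :
    (forall tau, tau \in `[0, T] -> Lq Omega +oo%E (g tau)) ->
    Lq_norm Omega +oo%E (g tau) @[tau --> within `[0, T] F] --> 0 ->
    L2_norm (g tau) @[tau --> within `[0, T] F] --> 0.
  move=> gL g0.
  apply: (@squeeze_cvgr _ _ _ _ (fun=> 0)
    (fun tau => c * Lq_norm Omega +oo%E (g tau))).
  - apply: filterS (withinT `[0, T]%classic FF) => tau /= tau0T.
    by rewrite L2_norm_ge0; have [] := cP _ (gL _ tau0T).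
  - exact: cvg_cst.
  - suff : c * Lq_norm Omega +oo%E (g tau) @[tau --> within `[0, T] F] --> c * 0.
      by rewrite mulr0.
    by apply: cvgM; [exact: cvg_cst|exact: g0].
have C0 psi : C0_Lq Omega +oo%E T psi -> C0_Lq Omega 2%:E T psi.
  move=> [pL cpsi]; split=> [t /pL/cP[]//|t t0T].
  apply: cvgL; first by move=> tau tau0T; apply: LB; exact: pL.
  exact: cpsi.
move=> [Cphi Cphi' dphi]; split; [exact: C0|exact: C0|move=> t t0T].
apply: cvgL; last exact: dphi.
move=> tau tau0T; apply: (LB); last exact: Cphi'.1.
by apply: LZ; apply: (LB); exact: Cphi.1.
Qed.

End bounded_domain.

(** * The convex energy of the flux *)

Section energy.
Context {R : realType} {d N : nat} (Omega : set 'rV[R]_d) (a alpha : 'I_N.+1 -> R).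
Hypothesis hg : forchheimer_data a alpha.
Local Notation mu := (lebesgue_rV d).
Local Notation E := 'rV[R]_d.
Local Notation L2 := (@L2 R d Omega).
Local Notation L2v := (@L2v R d Omega).
Local Notation L2_norm := (@L2_norm R d Omega).
Local Notation inner := (@inner R d Omega).
Local Notation innerv := (@innerv R d Omega).
Local Notation K := (Kfun a alpha).
Local Notation pot := (potential a alpha).
Implicit Types (v w : E -> E).

Definition flux v (x : E) : E := K (enorm (v x)) *: v x.

Definition energy v := \int[mu]_(x in Omega) pot (enorm (v x)).

(** Zero outside Omega is preserved by the square root of a sum of squares, so
restriction and norm commute. *)
Lemma measurable_enorm v : L2v v ->
  measurable_fun setT ((fun x => enorm (v x)) \_ Omega).
Proof.
move=> v2; have -> : (fun x => enorm (v x)) \_ Omega =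
    Num.sqrt \o (fun x => \sum_(i < d) ((fun x => v x ord0 i) \_ Omega) x ^+ 2).
  apply/funext => x /=; rewrite patchE; case: ifPn => xO.
    by congr Num.sqrt; apply: eq_bigr => i _; rewrite patchE xO expr2.
  by rewrite big1 ?sqrtr0// => i _; rewrite patchE (negbTE xO) expr0n.
apply: measurableT_comp.
  by apply: continuous_measurable_fun; exact: sqrt_continuous.
by apply: measurable_sum => i; apply: measurable_funX; exact: L2_measurable.
Qed.

Lemma L2_enorm v : L2v v -> L2 (fun x => enorm (v x)).
Proof.
move=> v2; apply: L2_of_integrable_sqr; first exact: measurable_enorm.
have [+ _] := integrable_dotv v2 v2.
rewrite [X in _ -> integrable_on _ X](_ : _ =
  (fun x => dotv (v x) (v x)))//.
by apply/funext => x; exact: sqr_enorm.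
Qed.

Lemma flux_L2v v : L2v v -> L2v (flux v).
Proof.
move=> v2 i; have c0 : 0 <= (a ord0)^-1 by rewrite invr_ge0 ltW// (coef0_gt0 hg).
apply: (L2_dominated _ _ (L2Z (a ord0)^-1 (L2_enorm v2))).
  have -> : (fun x => flux v x ord0 i) \_ Omega =
      (K \o (fun x => enorm (v x)) \_ Omega) \* ((fun x => v x ord0 i) \_ Omega).
    apply/funext => x /=; rewrite !patchE; case: ifP; rewrite ?mulr0//.
    by rewrite mxE.
  apply: measurable_funM; last exact: L2_measurable.
  apply: measurableT_comp; first exact: measurable_Kfun.
  exact: measurable_enorm.
move=> x _; rewrite mxE normrM ler_pM// ?coord_le_enorm//.
by rewrite ger0_norm ?(Kfun_ge0 hg)// (Kfun_le hg).
Qed.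

Lemma integrable_energy v : L2v v -> integrable_on Omega (fun x => pot (enorm (v x))).
Proof.
move=> v2; have v2e := L2_enorm v2.
apply: (le_integrable measurableT _ _ (integrable_mul v2e (L2Z (a ord0)^-1 v2e))).
  apply/measurable_EFinP; rewrite (@restrict_comp R d Omega pot)//; last first.
    exact: potential0 hg.
  apply: measurableT_comp; first exact: measurable_potential.
  exact: measurable_enorm.
move=> x _ /=; rewrite lee_fin !patchE; case: ifPn => // _.
have e0 := enorm_ge0 (v x).
rewrite ger0_norm ?(potential_ge0 hg)// (le_trans (potential_le_mul hg e0))//.
apply: le_trans (ler_norm _); rewrite mulrCA -(Kfun_mul hg e0) -mulrA.
by rewrite ler_wpM2r ?mulr_ge0// (Kfun_le hg).
Qed.

(** The radial inequality becomes vectorial because the Cauchy-Schwarz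
inequality z . y <= |z| |y| has the right sign. *)
Lemma potential_le_dot (y z : 'rV[R]_d) :
  pot (enorm z) - pot (enorm y) <= dotv (K (enorm z) *: z) (z - y).
Proof.
apply: (le_trans (potential_le hg (enorm_ge0 _) (enorm_ge0 _))).
rewrite dotvZl dotvBr -sqr_enorm -(Kfun_mul hg (enorm_ge0 _)) -mulrA.
apply: ler_wpM2l; first exact: Kfun_ge0.
by rewrite mulrBr expr2 lerD2l lerN2 dotv_le.
Qed.

Lemma energy_le v w : L2v v -> L2v w ->
  energy w - energy v <= innerv (flux w) (fun x => w x - v x).
Proof.
move=> v2 w2; have wv2 := L2vB w2 v2; have fw2 := flux_L2v w2.
have iv := integrable_energy v2; have iw := integrable_energy w2.
have [idot _] := integrable_dotv fw2 wv2.
rewrite /energy -Rintegral_onB; [|exact: iw|exact: iv].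
apply: le_Rintegral_on => [||x _]; [exact: integrable_onB|exact: idot|].
rewrite /flux; have := potential_le_dot (v x) (w x).
by set A := (X in X <= _); set B := (X in _ <= X).
Qed.

(** The two subgradient inequalities between v and w, added. *)
Lemma flux_monotone v w : L2v v -> L2v w ->
  0 <= innerv (flux w) (fun x => w x - v x) + innerv (flux v) (fun x => v x - w x).
Proof.
move=> v2 w2; move: (energy_le v2 w2) (energy_le w2 v2).
move: (energy v) (energy w) (innerv _ _) (innerv _ _) => A B C D; lra.
Qed.

Lemma energy_ge0 v : 0 <= energy v.
Proof. by apply: Rintegral_ge0 => x _; exact: potential_ge0. Qed.

Lemma innerv_flux_le w z : L2v w -> L2v z ->
  innerv (flux w) z <= (a ord0)^-1 * L2_norm (fun x => enorm (w x)) *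
    L2_norm (fun x => enorm (z x)).
Proof.
move=> w2 z2; have [fz _] := integrable_dotv (flux_L2v w2) z2.
have a0 : 0 < (a ord0)^-1 by rewrite invr_gt0 (coef0_gt0 hg).
have we := L2Z (a ord0)^-1 (L2_enorm w2); have ze := L2_enorm z2.
apply: (@le_trans _ _ (inner (fun x => (a ord0)^-1 * enorm (w x)) (fun x => enorm (z x)))).
  apply: le_Rintegral_on => [||x _]; [exact: fz|exact: integrable_mul|].
  apply: le_trans (dotv_le _ _) _; rewrite ler_wpM2r ?enorm_ge0//.
  rewrite -(@ler_pXn2r _ 2)// ?nnegrE ?mulr_ge0 ?enorm_ge0 ?(ltW a0)//.
  rewrite sqr_enorm dotvZl dotvC dotvZl -sqr_enorm mulrA -expr2 exprMn.
  rewrite ler_wpM2r ?sqr_ge0// ler_pXn2r ?nnegrE ?(Kfun_ge0 hg) ?(ltW a0)//.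
  exact: Kfun_le hg _.
apply: (le_trans (inner_le we ze)).
by rewrite L2_normZ ?(gtr0_norm a0)//; exact: L2_enorm.
Qed.

(** The energy is locally Lipschitz because the flux is bounded by the field
divided by a_0. *)
Lemma energy_dist v w : L2v v -> L2v w ->
  `|energy w - energy v| <= (a ord0)^-1 *
    (L2_norm (fun x => enorm (v x)) + L2_norm (fun x => enorm (w x))) *
    L2_norm (fun x => enorm (w x - v x)).
Proof.
have a0 : 0 <= (a ord0)^-1 by rewrite invr_ge0 ltW// (coef0_gt0 hg).
have key v' w' : L2v v' -> L2v w' -> energy w' - energy v' <= (a ord0)^-1 *
    (L2_norm (fun x => enorm (v' x)) + L2_norm (fun x => enorm (w' x))) *
    L2_norm (fun x => enorm (w' x - v' x)).
  move=> v2 w2; apply: (le_trans (energy_le v2 w2)).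
  apply: (le_trans (innerv_flux_le w2 (L2vB w2 v2))).
  by rewrite ler_wpM2r ?L2_norm_ge0// ler_wpM2l// lerDr L2_norm_ge0.
move=> v2 w2; rewrite ler_norml key// andbT lerNl opprB.
have := key _ _ w2 v2; rewrite [X in _ * X * _]addrC.
congr (_ <= _ * L2_norm _); apply/funext => x.
by rewrite -enormN opprB.
Qed.

Lemma sqr_L2_norm_enorm v : L2v v ->
  L2_norm (fun x => enorm (v x)) ^+ 2 =
  \sum_(i < d) L2_norm (fun x => v x ord0 i) ^+ 2.
Proof.
move=> v2; rewrite sqr_L2_norm; last exact: L2_enorm.
under eq_bigr => i _ do rewrite (sqr_L2_norm (v2 i)).
rewrite -innervE// /Defs.inner /Defs.innerv.
by apply: eq_Rintegral => x _; rewrite -sqr_enorm expr2.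
Qed.

(** The pointwise growth bound of order beta, integrated; the L^beta norm is
finite since |v|^beta <= 1 + |v|^2 on the bounded set Omega. *)
Lemma energy_le_Lbeta v : bounded_set Omega -> L2v v ->
  energy v <= ((a ord_max)^-1) `^ (betaexp alpha - 1) *
    Lq_norm Omega (betaexp alpha)%:E (fun x => enorm (v x)) `^ betaexp alpha.
Proof.
move=> bO v2; have [B [mB OB Boo]] := bounded_sub_finite_measure bO.
set beta := betaexp alpha; set c := (_ `^ (beta - 1)).
have b1 : 1 < beta := betaexp_gt1 hg; have b2 : beta <= 2 := betaexp_le2 hg.
have c0 : 0 <= c := powR_ge0 _ _.
pose h := (fun x => enorm (v x)) \_ Omega.
have h0 x : 0 <= h x by rewrite /h patchE; case: ifP => // _; exact: enorm_ge0.
have mh : measurable_fun setT h := measurable_enorm v2.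
have mhb : measurable_fun setT (fun x => h x `^ beta).
  exact: (measurableT_comp (measurable_powR beta) mh).
have ihb : mu.-integrable setT (EFin \o (fun x => h x `^ beta)).
  have i1 : mu.-integrable setT (fun x => (\1_B x)%:E).
        apply/integrableP; split; first exact/measurable_EFinP.
    under eq_integral do rewrite /= ger0_norm//.
    by rewrite integral_indic// setIT.
  have i2 := integrableD measurableT i1 (integrable_mul (L2_enorm v2) (L2_enorm v2)).
  apply: (le_integrable measurableT _ _ i2); first exact/measurable_EFinP.
  move=> x _ /=; rewrite lee_fin ger0_norm ?powR_ge0//.
  rewrite /h !patchE; case: ifPn => [/set_mem Ox|_]; last first.
    by rewrite powR0 ?addr0 ?normr_ge0// gt_eqF// (lt_trans ltr01).
  have e0 := enorm_ge0 (v x).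
  rewrite indicE (mem_set (OB x Ox)) ger0_norm ?addr_ge0 ?mulr_ge0//.
  have [e1|e1] := leP (enorm (v x)) 1.
    rewrite (@le_trans _ _ 1)// ?lerDl ?mulr_ge0//.
    have b1E : 1 `^ beta = 1 :> R by rewrite powR1.
    rewrite -[leRHS]b1E.
    by rewrite ge0_ler_powR ?nnegrE// ltW// (lt_trans ltr01).
  rewrite (@le_trans _ _ (enorm (v x) `^ 2))//.
    by apply: ler_powR => //; exact: ltW.
  by rewrite powR_mulrn// expr2 lerDr.
have NE : Lq_norm Omega beta%:E (fun x => enorm (v x)) `^ beta =
    \int[mu]_x (h x `^ beta).
  have bn0 : beta != 0 by rewrite gt_eqF// (lt_trans ltr01).
  have := powR_Lnorm mu (EFin \o h) bn0.
  rewrite (_ : (\int[mu]_x _)%E = (\int[mu]_x (h x `^ beta)%:E)%E); last first.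
    by apply: eq_integral => x _ /=; rewrite ger0_norm.
  move=> NE; rewrite /Rintegral -NE.
  have Nfin : ('N[mu]_beta%:E[EFin \o h])%E \is a fin_num.
    rewrite ge0_fin_numE ?Lnorm_ge0// unlock poweR_lty//.
    have /integrableP[_] := ihb; apply: le_lt_trans.
    rewrite le_eqVlt; apply/orP; left; apply/eqP; apply: eq_integral => x _ /=.
    by rewrite (ger0_norm (h0 x)) ger0_norm ?powR_ge0//.
  by rewrite /Lq_norm -/h -(fineK Nfin) poweR_EFin.
rewrite NE -RintegralZl// /energy Rintegral_mkcond.
apply: le_Rintegral => //; first exact: integrable_energy.
  exact: (integrableZl measurableT c ihb).
move=> x _; rewrite /h !patchE; case: ifPn => _; last first.
  by rewrite powR0 ?mulr0// gt_eqF// (lt_trans ltr01).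
have e0 := enorm_ge0 (v x).
exact: le_trans (potential_le_mul hg e0) (sfun_growth hg e0).
Qed.

End energy.

(** * Curves with values in square integrable functions *)

Section curves.
Context {R : realType} {d : nat} (Omega : set 'rV[R]_d).
Local Notation E := 'rV[R]_d.
Local Notation L2 := (@L2 R d Omega).
Local Notation L2_norm := (@L2_norm R d Omega).
Local Notation inner := (@inner R d Omega).
Implicit Types (T t c : R) (p pt phi q : R -> E -> R) (psi : E -> R).

Lemma squeeze_dist (F : set_system R) {FF : Filter F} (f B : R -> R) (l : R) :
  (\forall k \near F, `|f k - l| <= B k) -> B k @[k --> F] --> 0 ->
  f k @[k --> F] --> l.
Proof.
move=> fB B0; apply/cvgrPdist_le => e e0.
near=> k; rewrite distrC; apply: (@le_trans _ _ (B k)); first by near: k.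
by near: k; apply: (cvgr_le _ B0).
Unshelve. all: by end_near. Qed.

Lemma cvg_near_eq (F : set_system R) {FF : Filter F} (f g : R -> R) (l l' : R) :
  (\forall k \near F, f k = g k) -> l = l' -> f k @[k --> F] --> l ->
  g k @[k --> F] --> l'.
Proof. by move=> fg <-; apply: cvg_trans; apply: near_eq_cvg. Qed.

Lemma L2_norm_cvg (F : set_system R) {FF : Filter F} (phi : R -> E -> R) psi :
  (\forall k \near F, L2 (phi k)) -> L2 psi ->
  L2_norm (fun x => phi k x - psi x) @[k --> F] --> 0 ->
  L2_norm (phi k) @[k --> F] --> L2_norm psi.
Proof.
move=> phi2 psi2; apply: squeeze_dist.
by apply: filterS phi2 => k k2; exact: ler_L2_dist.
Qed.

(** Continuity of the inner product, by
(phi, chi) - (psi, xi) = (phi - psi, chi) + (psi, chi - xi). *)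
Lemma inner_cvg (F : set_system R) {FF : Filter F} (phi chi : R -> E -> R) psi xi :
  (\forall k \near F, L2 (phi k)) -> (\forall k \near F, L2 (chi k)) ->
  L2 psi -> L2 xi ->
  L2_norm (fun x => phi k x - psi x) @[k --> F] --> 0 ->
  L2_norm (fun x => chi k x - xi x) @[k --> F] --> 0 ->
  inner (phi k) (chi k) @[k --> F] --> inner psi xi.
Proof.
move=> phi2 chi2 psi2 xi2 phi0 chi0.
pose B k := L2_norm (fun x => phi k x - psi x) * L2_norm (chi k) +
  L2_norm psi * L2_norm (fun x => chi k x - xi x).
apply: (@squeeze_dist _ _ _ B).
  near=> k.
  have pk : L2 (phi k) by near: k.
  have ck : L2 (chi k) by near: k.
  have -> : inner (phi k) (chi k) - inner psi xi =
      inner (fun x => phi k x - psi x) (chi k) +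
      inner psi (fun x => chi k x - xi x).
    rewrite innerBl// (innerC _ psi (fun x => chi k x - xi x)) innerBl//.
    by rewrite !(innerC _ _ psi) addrA subrK.
  apply: (le_trans (ler_normD _ _)); rewrite lerD// normr_inner_le//; exact: L2B.
have := cvgD (cvgM phi0 (L2_norm_cvg chi2 xi2 chi0)) (cvgM (cvg_cst (L2_norm psi)) chi0).
by rewrite mul0r mulr0 addr0; apply.
Unshelve. all: by end_near. Qed.

Definition right_derivative (q : R -> E -> R) (q' : E -> R) t :=
  L2_norm (fun x => k^-1 * (q (t + k) x - q t x) - q' x) @[k --> (0 : R)^'+] --> 0.

Lemma right_derivative_continuous q (q' : E -> R) t :
  (\forall k \near (0 : R)^'+, L2 (q (t + k))) -> L2 (q t) -> L2 q' ->
  right_derivative q q' t ->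
  L2_norm (fun x => q (t + k) x - q t x) @[k --> (0 : R)^'+] --> 0.
Proof.
move=> q2 qt2 q'2 dq.
pose Q k x := k^-1 * (q (t + k) x - q t x).
have Q2 : \forall k \near (0 : R)^'+, L2 (Q k).
  by apply: filterS q2 => k k2; apply: L2Z; exact: L2B.
have Qcvg : L2_norm (Q k) @[k --> (0 : R)^'+] --> L2_norm q'.
  exact: (@L2_norm_cvg ((0 : R)^'+) _ Q q' Q2 q'2 dq).
have id0 : k @[k --> (0 : R)^'+] --> (0 : R).
  by apply: cvg_at_right_filter; exact: (@cvg_id _ (nbhs (0 : R))).
apply: (cvg_near_eq _ _ (cvgM id0 Qcvg)); last by rewrite mul0r.
near=> k; have k0 : 0 < k by near: k; exact: nbhs_right_gt.
have k2 : L2 (q (t + k)) by near: k.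
rewrite L2_normZ; last exact: L2B.
by rewrite normfV gtr0_norm// mulrA mulfV ?mul1r// gt_eqF.
Unshelve. all: by end_near. Qed.

Lemma right_derivativeB p (p' : E -> R) q (q' : E -> R) t :
  (\forall k \near (0 : R)^'+, L2 (p (t + k))) -> L2 (p t) -> L2 p' ->
  (\forall k \near (0 : R)^'+, L2 (q (t + k))) -> L2 (q t) -> L2 q' ->
  right_derivative p p' t -> right_derivative q q' t ->
  right_derivative (fun r x => p r x - q r x) (fun x => p' x - q' x) t.
Proof.
move=> pk pt p'2 qk qt q'2 dp dq.
apply: squeeze_dist (_ : _ --> _); last first.
  by have := cvgD dp dq; rewrite addr0; apply.
near=> k; have pk2 : L2 (p (t + k)) by near: k.
have qk2 : L2 (q (t + k)) by near: k.
rewrite subr0 ger0_norm ?L2_norm_ge0//=.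
have P2 : L2 (fun x => k^-1 * (p (t + k) x - p t x) - p' x).
  by apply: L2B => //; apply: L2Z; exact: L2B.
have Q2 : L2 (fun x => k^-1 * (q (t + k) x - q t x) - q' x).
  by apply: L2B => //; apply: L2Z; exact: L2B.
have := ler_L2_normD P2 (L2Z (-1) Q2).
rewrite (L2_normZ _ Q2) normrN1 mul1r; apply: le_trans.
rewrite le_eqVlt; apply/orP; left; apply/eqP; congr Defs.L2_norm.
by apply/funext => x; ring.
Unshelve. all: by end_near. Qed.

(** |a|^2 - |b|^2 = (a - b, a + b), and the second factor tends to 2 q(t). *)
Lemma sqnorm_right_derivative q (q' : E -> R) t :
  (\forall k \near (0 : R)^'+, L2 (q (t + k))) -> L2 (q t) -> L2 q' ->
  right_derivative q q' t ->
  k^-1 * (L2_norm (q (t + k)) ^+ 2 - L2_norm (q t) ^+ 2) @[k --> (0 : R)^'+] -->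
  2 * inner q' (q t).
Proof.
move=> q2 qt2 q'2 dq.
pose Q k x := k^-1 * (q (t + k) x - q t x).
have Q2 : \forall k \near (0 : R)^'+, L2 (Q k).
  by apply: filterS q2 => k k2; apply: L2Z; exact: L2B.
have S2 : \forall k \near (0 : R)^'+, L2 (fun x => q (t + k) x + q t x).
  by apply: filterS q2 => k k2; exact: L2D.
have Scvg : L2_norm (fun x => (q (t + k) x + q t x) - 2 * q t x) @[k --> (0 : R)^'+] --> 0.
  apply: (cvg_near_eq _ (erefl 0) (right_derivative_continuous q2 qt2 q'2 dq)).
  apply: nearW => k; congr Defs.L2_norm; apply/funext => x; ring.
have : inner (Q k) (fun x => q (t + k) x + q t x) @[k --> (0 : R)^'+] -->
    inner q' (fun x => 2 * q t x).
  exact: (@inner_cvg ((0 : R)^'+) _ Q (fun k x => q (t + k) x + q t x) q'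
    (fun x => 2 * q t x) Q2 S2 q'2 (L2Z 2 qt2) dq Scvg).
move=> QS; apply: (cvg_near_eq _ _ QS); last first.
  by rewrite (innerC _ q') (innerZl _ qt2 q'2) (innerC _ _ q').
near=> k.
have k2 : L2 (q (t + k)) by near: k.
rewrite /Q innerZl//; [|exact: L2B|exact: L2D].
rewrite innerBl//; last exact: L2D.
rewrite 2!(innerC _ _ (fun x => _ + _)) !innerDl// (innerC _ (q t) (q (t + k))).
by rewrite -!sqr_L2_norm//; congr (_ * _); ring.
Unshelve. all: by end_near. Qed.

(** Translates convergence within [0, T] into one-sided limits at 0. *)
Lemma cvg_shift_within (T t : R) : 0 <= t -> t < T ->
  t + k @[k --> (0 : R)^'+] --> within `[0, T] t^'.
Proof.
move=> t0 tT A; rewrite /within/= => /nbhs_ballP[e /= e0 eA].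
suff : \forall k \near (0 : R)^'+, A (t + k) by [].
near=> k; have k0 : 0 < k by near: k; exact: nbhs_right_gt.
apply: eA.
- have tk : t - (t + k) = - k by ring.
  rewrite /ball/= tk normrN gtr0_norm//.
- by rewrite gt_eqF// ltrDl.
- rewrite /= in_itv/= addr_ge0 ?(ltW k0)//= -lerBrDl.
  by near: k; apply: nbhs_right_le; rewrite subr_gt0.
Unshelve. all: by end_near. Qed.

Lemma near_L2_shift T (phi : R -> E -> R) t : (forall r, r \in `[0, T] -> L2 (phi r)) ->
  0 <= t -> t < T -> \forall k \near (0 : R)^'+, L2 (phi (t + k)).
Proof.
move=> phi2 t0 tT; near=> k; apply: phi2; rewrite in_itv/=.
have k0 : 0 < k by near: k; exact: nbhs_right_gt.
rewrite addr_ge0 ?(ltW k0)//= -lerBrDl.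
by near: k; apply: nbhs_right_le; rewrite subr_gt0.
Unshelve. all: by end_near. Qed.

Lemma C1_right_derivative T p pt t : C1_Lq Omega 2%:E T p pt -> 0 <= t -> t < T ->
  right_derivative p (pt t) t.
Proof.
move=> [_ _ dp] t0 tT.
have tT' : t \in `[0, T] by rewrite in_itv/= t0 ltW.
have dp' := cvg_comp _ _ (cvg_shift_within t0 tT) (dp t tT').
apply: (cvg_near_eq _ (erefl 0) dp'); apply: nearW => k /=.
by rewrite (addrC t) addrK.
Qed.

Lemma C0_right_continuous T phi t : C0_Lq Omega 2%:E T phi -> 0 <= t -> t < T ->
  L2_norm (fun x => phi (t + k) x - phi t x) @[k --> (0 : R)^'+] --> 0.
Proof.
move=> [_ cphi] t0 tT.
have tT' : t \in `[0, T] by rewrite in_itv/= t0 ltW.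
apply: cvg_comp (cphi t tT') => A wA; apply: (cvg_shift_within t0 tT).
exact: nbhs_dnbhs wA.
Qed.

Lemma C0_dist_continuous T phi psi : C0_Lq Omega 2%:E T phi -> L2 psi ->
  {within `[0, T], continuous (fun t => L2_norm (fun x => phi t x - psi x))}.
Proof.
move=> [phi2 cphi] psi2; apply/subspace_continuousP => t t0T.
have near2 : \forall r \near within `[0, T] (nbhs t), L2 (phi r).
  by apply: filterS (withinT `[0, T]%classic (nbhs_filter t)) => r; exact: phi2.
pose chi r x := phi r x - psi x.
have chi2 : \forall r \near within `[0, T] (nbhs t), L2 (chi r).
  by apply: filterS near2 => r r2; exact: L2B.
apply: (@L2_norm_cvg (within `[0, T] (nbhs t)) _ chi (chi t) chi2).
  by apply: L2B => //; exact: phi2.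
apply: (cvg_near_eq _ (erefl 0) (cphi t t0T)); apply: nearW => r.
by congr Defs.L2_norm; apply/funext => x; rewrite /chi; ring.
Qed.

Lemma C0_norm_continuous T phi : C0_Lq Omega 2%:E T phi ->
  {within `[0, T], continuous (fun t => L2_norm (phi t))}.
Proof.
move=> cphi; have := C0_dist_continuous cphi (L2_cst0 _).
have -> : (fun t => L2_norm (fun x => phi t x - 0)) = (fun t => L2_norm (phi t)).
  by apply/funext => t; congr Defs.L2_norm; apply/funext => x; rewrite subr0.
by [].
Qed.

Lemma C0_diff_continuous T phi h : C0_Lq Omega 2%:E T phi -> 0 <= h ->
  {within `[0, T - h], continuous (fun r => L2_norm (fun x => phi (r + h) x - phi r x))}.
Proof.
move=> [phi2 cphi] h0; apply/subspace_continuousP => t /= tTh.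
have inT r : r \in `[0, T - h] -> r \in `[0, T] /\ r + h \in `[0, T].
  rewrite !in_itv/= => /andP[r0 rh]; rewrite r0 addr_ge0//= -lerBrDr rh.
  by split => //; rewrite (le_trans rh)// lerBlDr lerDl.
have [tT thT] := inT _ tTh.
pose F := within `[0, T - h]%classic (nbhs t).
have FA : F `[0, T - h]%classic := withinT `[0, T - h]%classic (nbhs_filter t).
have cvg1 : L2_norm (fun x => phi r x - phi t x) @[r --> F] --> 0.
  apply: cvg_comp (cphi t tT) => A; rewrite /F /within/= => wA.
  by apply: filterS wA => r rA rTh; apply: rA; have [] := inT r rTh.
have cvg2 : L2_norm (fun x => phi (r + h) x - phi (t + h) x) @[r --> F] --> 0.
  have sh : r + h @[r --> F] --> within `[0, T]%classic (nbhs (t + h)).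
    move=> A; rewrite /F /within/= => /nbhs_ballP[e /= e0 eA].
    apply/nbhs_ballP; exists e => //= r rt /inT[_ rhT]; apply: eA => //.
    by move: rt; rewrite /ball/= opprD addrACA subrr addr0.
  exact: (cvg_comp _ _ sh (cphi _ thT)).
apply: squeeze_dist (_ : _ --> _); last first.
  by have := cvgD cvg2 cvg1; rewrite addr0; apply.
apply: filterS FA => r /inT[rT rhT].
have r2 := phi2 r rT; have rh2 := phi2 _ rhT.
have t2 := phi2 t tT; have th2 := phi2 _ thT.
apply: (le_trans (ler_L2_dist (L2B rh2 r2) (L2B th2 t2))).
have := ler_L2_normD (L2B rh2 th2) (L2B t2 r2).
rewrite (L2_norm_distC t2 r2); apply: le_trans.
rewrite le_eqVlt; apply/orP; left; apply/eqP; congr Defs.L2_norm.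
by apply/funext => x; ring.
Qed.

(** The distance to the starting point of the curve has a Dini derivative
bounded by the norm of the velocity. *)
Lemma mean_value_inequality T p pt t h c : C1_Lq Omega 2%:E T p pt ->
  0 <= t -> 0 <= h -> t + h <= T ->
  (forall r, t < r < t + h -> L2_norm (pt r) <= c) ->
  L2_norm (fun x => p (t + h) x - p t x) <= c * h.
Proof.
move=> Cp t0 h0 thT ptc; have [[p2 cp] [pt2 _] _] := Cp.
have tT : t <= T by rewrite (le_trans _ thT)// lerDl.
have pt_2 : L2 (p t) by apply: p2; rewrite in_itv/= t0.
pose F r := L2_norm (fun x => p r x - p t x).
have Ft : F t = 0.
  have -> : F t = L2_norm (fun x => 0 * p t x).
    by congr Defs.L2_norm; apply/funext => x; rewrite subrr mul0r.
  by rewrite L2_normZ// normr0 mul0r.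
have := @dini_le R F t (t + h) c; rewrite Ft subr0 (addrAC t) subrr add0r lerDl.
apply => //.
- apply: continuous_subspaceW (C0_dist_continuous (conj p2 cp) pt_2).
  by apply: subset_itvScc.
move=> r trh e e0; have /andP[tr rth] := trh.
have r0 : 0 <= r by rewrite (le_trans t0)// ltW.
have rT : r < T by exact: lt_le_trans thT.
have r0T : r \in `[0, T] by rewrite in_itv/= r0 ltW.
have dp := C1_right_derivative Cp r0 rT.
have near2 := near_L2_shift p2 r0 rT.
have Q2 : \forall k \near (0 : R)^'+, L2 (fun x => k^-1 * (p (r + k) x - p r x)).
  by apply: filterS near2 => k k2; apply: L2Z; apply: L2B => //; exact: p2.
have /cvgr_le Qcvg : L2_norm (fun x => k^-1 * (p (r + k) x - p r x)) @[k --> (0 : R)^'+] -->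
    L2_norm (pt r).
  exact: (@L2_norm_cvg ((0 : R)^'+) _ (fun k x => k^-1 * (p (r + k) x - p r x)) (pt r)
    Q2 (pt2 r r0T) dp).
have ptrc := ptc r trh.
near=> k; have k0 : 0 < k by near: k; exact: nbhs_right_gt.
have k2 : L2 (p (r + k)) by near: k.
have : L2_norm (fun x => k^-1 * (p (r + k) x - p r x)) <= c + e.
  by near: k; apply: Qcvg; rewrite (le_lt_trans ptrc)// ltrDl.
have pr2 := p2 r r0T.
rewrite L2_normZ; last exact: L2B.
rewrite normfV gtr0_norm// ler_pdivrMl// => pk.
have := ler_L2_normD (L2B k2 pr2) (L2B pr2 pt_2).
have -> : (fun x => p (r + k) x - p r x + (p r x - p t x)) =
    (fun x => p (r + k) x - p t x) by apply/funext => x; ring.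
rewrite -/(F r) -/(F (r + k)).
move: (L2_norm _) pk => A; lra.
Unshelve. all: by end_near. Qed.

End curves.

(** * Estimates for the solution *)

Section solution.
Context {R : realType} {d N : nat} (Omega : set 'rV[R]_d) (a alpha : 'I_N.+1 -> R).
Hypothesis hg : forchheimer_data a alpha.
Local Notation mu := (lebesgue_rV d).
Local Notation E := 'rV[R]_d.
Local Notation L2 := (@L2 R d Omega).
Local Notation L2v := (@L2v R d Omega).
Local Notation L2_norm := (@L2_norm R d Omega).
Local Notation inner := (@inner R d Omega).
Local Notation innerv := (@innerv R d Omega).
Local Notation flux := (flux a alpha).
Local Notation energy := (energy Omega a alpha).

(** The divergence is chosen among the square integrable weak divergences,
which exist on the space V. *)
Lemma L2_divergence v : Vspace Omega v -> L2 (divergence Omega v).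
Proof.
move=> [_ ex _]; rewrite /divergence.
by have [] := @xgetPex _ (fun=> 0) [set dv | L2 dv /\ weak_divergence Omega v dv] ex.
Qed.

Lemma innervC (v w : E -> E) : innerv v w = innerv w v.
Proof. by apply: eq_Rintegral => x _; exact: dotvC. Qed.

Context (T : R) (f ft : R -> E -> R) (p0 : E -> R) (p pt : R -> E -> R)
  (s u : R -> E -> E).
Hypothesis Cf : C1_Lq Omega 2%:E T f ft.
Hypothesis Cp : C1_Lq Omega 2%:E T p pt.
Hypothesis Cs : forall i, C0_Lq Omega 2%:E T (fun tau x => s tau x ord0 i).
Hypothesis sol : mixed_solution Omega (Kfun a alpha) T f p0 p pt s u.

Lemma itv_oo_cc t : t \in `]0, T[ -> t \in `[0, T].
Proof. by rewrite !in_itv/= => /andP[/ltW-> /ltW->]. Qed.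

Let p2 t : t \in `[0, T] -> L2 (p t). Proof. by have [[+ _] _ _] := Cp; apply. Qed.
Let pt2 t : t \in `[0, T] -> L2 (pt t). Proof. by have [_ [+ _] _] := Cp; apply. Qed.
Let f2 t : t \in `[0, T] -> L2 (f t). Proof. by have [[+ _] _ _] := Cf; apply. Qed.
Let s2 t : t \in `[0, T] -> L2v (s t).
Proof. by move=> t0T i; have [+ _] := Cs i; apply. Qed.

(** The flux u(t) is the test field in the equation of s at both times t1 and
t2, and the increments of s and p are the test functions in the two equations
at time t; the products of div u(t) with p(t1) and p(t2) cancel. *)
Lemma test_identity t t1 t2 :
  t \in `]0, T[ -> t1 \in `]0, T[ -> t2 \in `]0, T[ ->
  innerv (flux (s t)) (fun x => s t1 x - s t2 x) =
  inner (fun x => f t x - pt t x) (fun x => p t1 x - p t2 x).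
Proof.
move=> tI t1I t2I.
have [[tT t1T] t2T] := (itv_oo_cc tI, itv_oo_cc t1I, itv_oo_cc t2I).
have uV := mixed_u sol tT.
have u2 : L2v (u t) by case: uV.
have div2 := L2_divergence uV.
have z2 := L2vB (s2 t1T) (s2 t2T).
have dp2 := L2B (p2 t1T) (p2 t2T).
have := mixed_eq2 sol tI z2.
have := mixed_eq3 sol t1I uV.
have := mixed_eq3 sol t2I uV.
have := mixed_eq1 sol tI dp2.
rewrite (innervC (u t)) (innerv_Bl (s2 t1T) (s2 t2T) u2).
rewrite (innerC _ (divergence _ _)) (innerBl (p2 t1T) (p2 t2T) div2).
rewrite (innerBl (f2 tT) (pt2 tT) dp2).
rewrite -/(flux (s t)).
move: (inner (pt t) _) (inner (f t) _) (inner (p t1) _) (inner (p t2) _).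
move: (innerv (s t1) _) (innerv (s t2) _) (innerv (flux _) _).
move=> A B C D A' B' C'; lra.
Qed.

(** Monotonicity of the flux between the times t1 and t2, read through the
test identity at both times. *)
Lemma difference_monotone t1 t2 : t1 \in `]0, T[ -> t2 \in `]0, T[ ->
  inner (fun x => pt t1 x - pt t2 x) (fun x => p t1 x - p t2 x) <=
  inner (fun x => f t1 x - f t2 x) (fun x => p t1 x - p t2 x).
Proof.
move=> t1I t2I; have [t1T t2T] := (itv_oo_cc t1I, itv_oo_cc t2I).
have dp2 := L2B (p2 t1T) (p2 t2T).
have := flux_monotone hg (s2 t2T) (s2 t1T).
rewrite (test_identity t1I t1I t2I) (test_identity t2I t2I t1I).
have -> : (fun x => p t2 x - p t1 x) = (fun x => -1 * (p t1 x - p t2 x)).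
  by apply/funext => x; ring.
rewrite (innerC _ _ (fun x => -1 * _)) (innerZl _ dp2 (L2B (f2 t2T) (pt2 t2T))).
rewrite (innerC _ (fun x => p t1 x - p t2 x)).
rewrite (innerBl (f2 t1T) (pt2 t1T) dp2) (innerBl (f2 t2T) (pt2 t2T) dp2).
rewrite (innerBl (f2 t1T) (f2 t2T) dp2) (innerBl (pt2 t1T) (pt2 t2T) dp2).
move: (inner (pt t1) _) (inner (f t1) _) (inner (pt t2) _) (inner (f t2) _).
move=> A B C D; lra.
Qed.

Lemma energy_continuous : {within `[0, T], continuous (fun t => energy (s t))}.
Proof.
apply/subspace_continuousP => t /= t0T.
pose F := within `[0, T]%classic (nbhs t).
have FA : F `[0, T]%classic := withinT `[0, T]%classic (nbhs_filter t).
have dcvg : L2_norm (fun x => enorm (s r x - s t x)) @[r --> F] --> 0.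
  have sum0 : \sum_(i < d) L2_norm (fun x => (s r x - s t x) ord0 i) ^+ 2 @[r --> F] -->
      \sum_(i < d) (0 : R) ^+ 2.
    apply: cvg_sumR => i; have [_ /(_ t t0T) ci] := Cs i.
    apply: (cvg_near_eq _ _ (cvgM ci ci)); last by rewrite expr2.
    apply: nearW => r; rewrite -expr2; congr (L2_norm _ ^+ 2); apply/funext => x.
    by rewrite !mxE.
  have sqrt0 := cvg_comp _ _ sum0 (@sqrt_continuous R _).
  apply: (cvg_near_eq _ _ sqrt0); last first.
    by rewrite big1 ?sqrtr0// => i _; rewrite expr0n.
  apply: filterS FA => r rT /=; rewrite -sqr_L2_norm_enorm; last exact: L2vB (s2 rT) (s2 t0T).
  by rewrite sqrtr_sqr ger0_norm ?L2_norm_ge0.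
have ncvg : L2_norm (fun x => enorm (s r x)) @[r --> F] --> L2_norm (fun x => enorm (s t x)).
  have sum0 : \sum_(i < d) L2_norm (fun x => s r x ord0 i) ^+ 2 @[r --> F] -->
      \sum_(i < d) L2_norm (fun x => s t x ord0 i) ^+ 2.
    apply: cvg_sumR => i; have := C0_norm_continuous (Cs i).
    move=> /subspace_continuousP/(_ t t0T) ci.
    apply: (cvg_near_eq _ _ (cvgM ci ci)); last by rewrite expr2.
    by apply: nearW => r; rewrite expr2.
  have sqrt0 := cvg_comp _ _ sum0 (@sqrt_continuous R _).
  apply: (cvg_near_eq _ _ sqrt0); last first.
    by rewrite -sqr_L2_norm_enorm ?sqrtr_sqr ?ger0_norm ?L2_norm_ge0//; exact: s2.
  apply: filterS FA => r rT /=; rewrite -sqr_L2_norm_enorm; last exact: s2.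
  by rewrite sqrtr_sqr ger0_norm ?L2_norm_ge0.
pose B r := (a ord0)^-1 * (L2_norm (fun x => enorm (s t x)) +
  L2_norm (fun x => enorm (s r x))) * L2_norm (fun x => enorm (s r x - s t x)).
apply: (@squeeze_dist _ _ _ _ B).
  by apply: filterS FA => r rT; exact: (energy_dist hg (s2 t0T) (s2 rT)).
rewrite -[X in _ --> X](mulr0 ((a ord0)^-1 * (L2_norm (fun x => enorm (s t x)) +
  L2_norm (fun x => enorm (s t x))))).
apply: (cvgM _ dcvg); apply: cvgM; first exact: cvg_cst.
by apply: cvgD ncvg; exact: cvg_cst.
Qed.

(** The subgradient is taken at the later time t + k, so that the increment of
the energy is bounded from above by (f - p_t)(t + k) tested against the
increment of p; these factors converge strongly. *)
Lemma energy_dini t : t \in `]0, T[ -> forall e, 0 < e ->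
  \forall k \near (0 : R)^'+, energy (s (t + k)) <=
    energy (s t) + k * (2^-1 * L2_norm (f t) ^+ 2 - 2^-1 * L2_norm (pt t) ^+ 2 + e).
Proof.
move=> tI e e0; have tT := itv_oo_cc tI.
have /andP[t0 t1] : 0 < t < T by move: tI; rewrite in_itv.
pose q k x := f (t + k) x - pt (t + k) x.
pose Q k x := k^-1 * (p (t + k) x - p t x).
have nearp := near_L2_shift p2 (ltW t0) t1.
have nearpt := near_L2_shift pt2 (ltW t0) t1.
have nearf := near_L2_shift f2 (ltW t0) t1.
have qt2 : L2 (fun x => f t x - pt t x) by apply: L2B; [exact: f2|exact: pt2].
have q2 : \forall k \near (0 : R)^'+, L2 (q k).
  by near=> k; apply: L2B; near: k.
have Q2 : \forall k \near (0 : R)^'+, L2 (Q k).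
  by near=> k; apply: L2Z; apply: L2B; [near: k|exact: p2].
have qcvg : L2_norm (fun x => q k x - (f t x - pt t x)) @[k --> (0 : R)^'+] --> 0.
  have cf : C0_Lq Omega 2%:E T f by case: Cf.
  have cpt : C0_Lq Omega 2%:E T pt by case: Cp.
  apply: (@squeeze_dist _ _ _ _ (fun k => L2_norm (fun x => f (t + k) x - f t x) +
    L2_norm (fun x => pt (t + k) x - pt t x))).
    near=> k; have fk : L2 (f (t + k)) by near: k.
    have ptk : L2 (pt (t + k)) by near: k.
    rewrite subr0 ger0_norm ?L2_norm_ge0// (L2_norm_distC ptk (pt2 tT)).
    have := ler_L2_normD (L2B fk (f2 tT)) (L2B (pt2 tT) ptk).
    apply: le_trans; rewrite le_eqVlt; apply/orP; left; apply/eqP.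
    by congr Defs.L2_norm; apply/funext => x; rewrite /q; ring.
  rewrite -[X in _ --> X](addr0 0); apply: cvgD.
    exact: C0_right_continuous cf (ltW t0) t1.
  exact: C0_right_continuous cpt (ltW t0) t1.
have Qcvg := C1_right_derivative Cp (ltW t0) t1.
have icvg : inner (q k) (Q k) @[k --> (0 : R)^'+] -->
    inner (fun x => f t x - pt t x) (pt t).
  exact: (@inner_cvg _ _ _ ((0 : R)^'+) _ q Q _ _ q2 Q2 qt2 (pt2 tT) qcvg Qcvg).
have lim_le : inner (fun x => f t x - pt t x) (pt t) <=
    2^-1 * L2_norm (f t) ^+ 2 - 2^-1 * L2_norm (pt t) ^+ 2.
  rewrite (innerBl (f2 tT) (pt2 tT) (pt2 tT)) -(sqr_L2_norm (pt2 tT)).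
  have := inner_le (f2 tT) (pt2 tT).
  have := sqr_ge0 (L2_norm (f t) - L2_norm (pt t)).
  move: (inner _ _) (L2_norm _) (L2_norm _) => A B C; nra.
have near_tk : \forall k \near (0 : R)^'+, t + k \in `]0, T[.
  near=> k; have k0 : 0 < k by near: k; exact: nbhs_right_gt.
  rewrite in_itv/= addr_gt0//= -ltrBrDl.
  by near: k; apply: nbhs_right_lt; rewrite subr_gt0.
near=> k; have k0 : 0 < k by near: k; exact: nbhs_right_gt.
have tkI : t + k \in `]0, T[ by near: k.
have tkT := itv_oo_cc tkI.
have := energy_le hg (s2 tT) (s2 tkT); rewrite (test_identity tkI tkI tI).
have -> : inner (fun x => f (t + k) x - pt (t + k) x) (fun x => p (t + k) x - p t x) =
    k * inner (q k) (Q k).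
  rewrite (innerC _ (q k)) (innerZl _ (L2B (p2 tkT) (p2 tT))); last first.
    by apply: L2B; [exact: f2|exact: pt2].
  by rewrite mulrA mulfV ?gt_eqF// mul1r innerC.
have : inner (q k) (Q k) <= 2^-1 * L2_norm (f t) ^+ 2 - 2^-1 * L2_norm (pt t) ^+ 2 + e.
  by near: k; apply: (cvgr_le _ icvg); rewrite (le_lt_trans lim_le)// ltrDl.
move: (inner _ _) (energy _) (energy _) (_ - _ + e) => A B C D.
rewrite -(ler_pM2l k0); lra.
Unshelve. all: by end_near. Qed.

(** The squared norm of the increment q of p over the lag h has right
derivative 2 (q', q), which monotonicity bounds by 2 (r, q) with r the
increment of f. *)
Lemma difference_growth h t1 t2 c : 0 < t1 -> t1 <= t2 -> 0 <= h -> t2 + h < T ->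
  (forall r, t1 < r < t2 -> 2 * (L2_norm (fun x => f (r + h) x - f r x) *
    L2_norm (fun x => p (r + h) x - p r x)) <= c) ->
  L2_norm (fun x => p (t2 + h) x - p t2 x) ^+ 2 -
  L2_norm (fun x => p (t1 + h) x - p t1 x) ^+ 2 <= c * (t2 - t1).
Proof.
move=> t10 t12 h0 t2h rc.
pose G r := L2_norm (fun x => p (r + h) x - p r x).
have Cp0 : C0_Lq Omega 2%:E T p by case: Cp.
apply: (@dini_le R (fun r => G r ^+ 2)) => //.
  have cG : {within `[t1, t2], continuous G}.
    apply: continuous_subspaceW (C0_diff_continuous Cp0 h0).
    apply: subset_itvScc; rewrite bnd_simp; first exact: ltW.
    by rewrite lerBrDr ltW.
  by move=> r; exact: (cvgM (cG r) (cG r)).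
move=> r /andP[t1r rt2] e e0.
have r0 : 0 < r by exact: lt_trans t1r.
have rhT : r + h < T by rewrite (lt_trans _ t2h)// ltrD2r.
have rT : r < T by rewrite (le_lt_trans _ rhT)// lerDl.
have rI : r \in `]0, T[ by rewrite in_itv/= r0.
have rhI : r + h \in `]0, T[ by rewrite in_itv/= rhT ltr_wpDr.
have [rc' rhc'] := (itv_oo_cc rI, itv_oo_cc rhI).
have nearr := near_L2_shift p2 (ltW r0) rT.
have nearrh : \forall k \near (0 : R)^'+, L2 (p (r + k + h)).
  apply: filterS (near_L2_shift p2 (addr_ge0 (ltW r0) h0) rhT) => k.
  by rewrite addrAC.
have dp1 : right_derivative Omega (fun r => p (r + h)) (pt (r + h)) r.
  have := C1_right_derivative Cp (addr_ge0 (ltW r0) h0) rhT.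
  apply: (cvg_near_eq _ (erefl 0)); apply: nearW => k.
  by rewrite (addrAC r k).
have dp2 := C1_right_derivative Cp (ltW r0) rT.
have dd := right_derivativeB nearrh (p2 rhc') (pt2 rhc') nearr (p2 rc') (pt2 rc') dp1 dp2.
have near2 : \forall k \near (0 : R)^'+, L2 (fun x => p (r + k + h) x - p (r + k) x).
  by near=> k; apply: L2B; near: k.
have := sqnorm_right_derivative near2 (L2B (p2 rhc') (p2 rc')) (L2B (pt2 rhc') (pt2 rc')) dd.
set l := inner _ _ => lcvg.
have lc : 2 * l <= c.
  apply: le_trans (rc r _); last by rewrite t1r.
  rewrite ler_pM2l//; apply: le_trans (difference_monotone rhI rI) _.
  by apply: inner_le; apply: L2B; first [exact: f2|exact: p2].
near=> k; have k0 : 0 < k by near: k; exact: nbhs_right_gt.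
have : k^-1 * (G (r + k) ^+ 2 - G r ^+ 2) <= c + e.
  by near: k; apply: (cvgr_le _ lcvg); rewrite (le_lt_trans lc)// ltrDl.
by rewrite ler_pdivrMl// lerBlDl.
Unshelve. all: by end_near. Qed.

(** By the mean value inequality the increments of p and f over the lag h are
at most h times slightly more than |p_t(t)| and |f_t(t)| as long as they are
taken near t.  With these bounds the growth of the increments over [t, t + k],
divided by h^2, passes to the limit h -> 0 for fixed k. *)
Lemma pt_dini t : t \in `]0, T[ -> forall e, 0 < e ->
  \forall k \near (0 : R)^'+, L2_norm (pt (t + k)) ^+ 2 <=
    L2_norm (pt t) ^+ 2 + k * (L2_norm (pt t) ^+ 2 + L2_norm (ft t) ^+ 2 + e).
Proof.
move=> tI e e0; have tT := itv_oo_cc tI.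
have /andP[t0 t1] : 0 < t < T by move: tI; rewrite in_itv.
set P := L2_norm (pt t); set Q := L2_norm (ft t).
have P0 : 0 <= P := L2_norm_ge0 _ _; have Q0 : 0 <= Q := L2_norm_ge0 _ _.
(* The tolerance e' on both norms costs 2 e' (P + Q + e') on the product,
   which has to stay below e. *)
have [e' e'0 PQe] : exists2 e', 0 < e' & 2 * ((Q + e') * (P + e')) <= P ^+ 2 + Q ^+ 2 + e.
  have PQ0 : 0 < 2 * (P + Q + 1) by lra.
  pose e' := Num.min 1 (e / (2 * (P + Q + 1))).
  have e'1 : e' <= 1 by rewrite ge_min lexx.
  have e'0 : 0 < e' by rewrite lt_min ltr01 divr_gt0.
  exists e' => //.
  have : e' * (2 * (P + Q + 1)) <= e by rewrite -ler_pdivlMr// ge_min lexx orbT.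
  have := sqr_ge0 (P - Q).
  have : e' * e' <= e' by rewrite ler_piMr// ltW.
  by nra.
have near_bound (phi : R -> E -> R) : C0_Lq Omega 2%:E T phi ->
    \forall k \near (0 : R)^'+, L2_norm (phi (t + k)) <= L2_norm (phi t) + e'.
  move=> Cphi; have [phi2 _] := Cphi.
  have cvgk : L2_norm (phi (t + k)) @[k --> (0 : R)^'+] --> L2_norm (phi t).
    apply: (@L2_norm_cvg _ _ _ ((0 : R)^'+) _ (fun k => phi (t + k)) (phi t)).
    - exact: near_L2_shift phi2 (ltW t0) t1.
    - exact: phi2.
    - exact: C0_right_continuous Cphi (ltW t0) t1.
  by apply: (cvgr_le _ cvgk); rewrite ltrDl.
have Cpt : C0_Lq Omega 2%:E T pt by case: Cp.
have Cft : C0_Lq Omega 2%:E T ft by case: Cf.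
have [e1 e10 ptP] := right_near_ball (near_bound _ Cpt).
have [e2 e20 ftQ] := right_near_ball (near_bound _ Cft).
(* With k and h below eta / 2, all times occurring in the increments lie
   between t and t + eta. *)
pose eta := Num.min (Num.min e1 e2) (T - t).
have eta0 : 0 < eta by rewrite !lt_min e10 e20 subr_gt0.
have [eta1 eta2 etaT] : [/\ eta <= e1, eta <= e2 & eta <= T - t].
  by rewrite /eta !ge_min !lexx !orbT.
near=> k; have k0 : 0 < k by near: k; exact: nbhs_right_gt.
have keta : k < eta / 2 by near: k; apply: nbhs_right_lt; rewrite divr_gt0.
have step h : 0 < h -> h < eta / 2 ->
    L2_norm (fun x => h^-1 * (p (t + k + h) x - p (t + k) x)) ^+ 2 -
    L2_norm (fun x => h^-1 * (p (t + h) x - p t x)) ^+ 2 <=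
    k * (P ^+ 2 + Q ^+ 2 + e).
  move=> h0 heta.
  have ptb r : t < r < t + k + h -> L2_norm (pt r) <= P + e'.
    move=> /andP[tr rk]; rewrite -(subrK t r) addrC; apply: ptP; lra.
  have ftb r : t < r < t + k + h -> L2_norm (ft r) <= Q + e'.
    move=> /andP[tr rk]; rewrite -(subrK t r) addrC; apply: ftQ; lra.
  have tkh : t + k + h < T by lra.
  have inT r : 0 < r -> r < T -> r \in `[0, T].
    by move=> r0 rT; rewrite in_itv/= !ltW.
  have ptkh : L2 (p (t + k + h)) by apply: p2; apply: inT; lra.
  have ptk : L2 (p (t + k)) by apply: p2; apply: inT; lra.
  have pth : L2 (p (t + h)) by apply: p2; apply: inT; lra.
  rewrite (L2_normZ _ (L2B ptkh ptk)) (L2_normZ _ (L2B pth (p2 tT))).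
  rewrite !exprMn -mulrBr real_normK ?num_real// exprVn ler_pdivrMl ?exprn_gt0//.
  have := @difference_growth h t (t + k) (2 * ((Q + e') * h * ((P + e') * h))) t0.
  rewrite (addrAC t k (- t)) subrr add0r => dg.
  apply: le_trans (dg _ _ _ _) _; [lra|lra|lra| |].
    move=> r /andP[tr rtk]; rewrite ler_pM2l//; apply: ler_pM; rewrite ?L2_norm_ge0//.
      apply: (mean_value_inequality Cf); [lra|lra|lra|move=> r' /andP[rr' r'h]].
      by apply: ftb; apply/andP; split; lra.
    apply: (mean_value_inequality Cp); [lra|lra|lra|move=> r' /andP[rr' r'h]].
    by apply: ptb; apply/andP; split; lra.
  have -> : 2 * ((Q + e') * h * ((P + e') * h)) * k =
      h ^+ 2 * (k * (2 * ((Q + e') * (P + e')))) by ring.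
  by rewrite ler_pM2l ?exprn_gt0// ler_pM2l.
have tkI : t + k \in `]0, T[ by rewrite in_itv/=; apply/andP; split; lra.
have cvgq r : r \in `]0, T[ ->
    L2_norm (fun x => h^-1 * (p (r + h) x - p r x)) ^+ 2 @[h --> (0 : R)^'+] -->
    L2_norm (pt r) ^+ 2.
  move=> rI; have /andP[r0 r1] : 0 < r < T by move: rI; rewrite in_itv.
  have rT := itv_oo_cc rI.
  have cq : L2_norm (fun x => h^-1 * (p (r + h) x - p r x)) @[h --> (0 : R)^'+] -->
      L2_norm (pt r).
    apply: (@L2_norm_cvg _ _ _ ((0 : R)^'+) _
      (fun h x => h^-1 * (p (r + h) x - p r x)) (pt r)).
    - apply: filterS (near_L2_shift p2 (ltW r0) r1) => h h2.
      by apply: L2Z; apply: L2B => //; exact: p2.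
    - exact: pt2.
    - exact: C1_right_derivative Cp (ltW r0) r1.
  exact: (cvgM cq cq).
rewrite -lerBlDl; apply: (cvgr_to_le (cvgB (cvgq _ tkI) (cvgq _ tI))).
near=> h; apply: step; first by near: h; exact: nbhs_right_gt.
by near: h; apply: nbhs_right_lt; rewrite divr_gt0.
Unshelve. all: by end_near. Qed.

Let sqr_cont (phi : R -> E -> R) : C0_Lq Omega 2%:E T phi ->
  {within `[0, T], continuous (fun t => L2_norm (phi t) ^+ 2)}.
Proof. by move=> /C0_norm_continuous c t; exact: (cvgM (c t) (c t)). Qed.

Let sub0T t1 t2 : 0 <= t1 -> t2 <= T -> `[t1, t2]%classic `<=` `[0, T]%classic.
Proof. by move=> t10 t2T; apply: subset_itvScc. Qed.

Lemma integral_sqr_pt_le t : 0 <= t -> t <= T ->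
  \int[lebesgue_measure]_(tau in `[0, t]) (L2_norm (pt tau) ^+ 2) <=
  2 * energy (s 0) +
  \int[lebesgue_measure]_(tau in `[0, t]) (L2_norm (f tau) ^+ 2).
Proof.
move=> t0 tT; have sub := sub0T (lexx 0) tT.
pose I (phi : R -> E -> R) :=
  \int[lebesgue_measure]_(tau in `[0, t]) (L2_norm (phi tau) ^+ 2).
rewrite -/(I f) -/(I pt).
have Et := energy_ge0 Omega hg (s t).
suff : energy (s t) - energy (s 0) <= 2^-1 * I f - 2^-1 * I pt.
  by move: Et; move: (energy (s t)) (energy (s 0)) (I f) (I pt) => A B C D; lra.
have cf : {within `[0, t], continuous (fun t => L2_norm (f t) ^+ 2)}.
  by apply: continuous_subspaceW sub _; apply: sqr_cont; case: Cf.
have cpt : {within `[0, t], continuous (fun t => L2_norm (pt t) ^+ 2)}.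
  by apply: continuous_subspaceW sub _; apply: sqr_cont; case: Cp.
have intf := continuous_itv_integrable t0 cf.
have intpt := continuous_itv_integrable t0 cpt.
have cE := continuous_subspaceW sub energy_continuous.
pose g tau := 2^-1 * L2_norm (f tau) ^+ 2 - 2^-1 * L2_norm (pt tau) ^+ 2.
have cg : {within `[0, t], continuous g}.
  move=> r; apply: cvgB; apply: cvgM; [exact: cvg_cst|exact: cf|exact: cvg_cst|exact: cpt].
have <- : \int[lebesgue_measure]_(tau in `[0, t]) g tau = 2^-1 * I f - 2^-1 * I pt.
  rewrite RintegralB//; [|exact: (integrableZl _ _ intf)|exact: (integrableZl _ _ intpt)].
  by rewrite !RintegralZl.
apply: (@dini_le_integral R (fun t => energy (s t)) g 0 t t0 cE cg) => r /andP[r0 rt].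
by apply: energy_dini; rewrite in_itv/= r0 (lt_le_trans rt).
Qed.

Lemma pt_le_integral t1 t2 : 0 <= t1 -> t1 <= t2 -> t2 <= T ->
  L2_norm (pt t2) ^+ 2 - L2_norm (pt t1) ^+ 2 <=
  \int[lebesgue_measure]_(tau in `[t1, t2])
    (L2_norm (pt tau) ^+ 2 + L2_norm (ft tau) ^+ 2).
Proof.
move=> t10 t12 t2T; have sub := sub0T t10 t2T.
have cft : {within `[t1, t2], continuous (fun t => L2_norm (ft t) ^+ 2)}.
  by apply: continuous_subspaceW sub _; apply: sqr_cont; case: Cf.
have cpt : {within `[t1, t2], continuous (fun t => L2_norm (pt t) ^+ 2)}.
  by apply: continuous_subspaceW sub _; apply: sqr_cont; case: Cp.
apply: (@dini_le_integral R (fun t => L2_norm (pt t) ^+ 2)) => //.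
  by move=> r; apply: cvgD; [exact: cpt|exact: cft].
move=> r /andP[t1r rt2]; apply: pt_dini.
by rewrite in_itv/= (le_lt_trans t10)//= (lt_le_trans rt2).
Qed.

(** [pt_le_integral] bounds |p_t(t)|^2 from each starting time r in [0, t0];
extending its integral to [0, t] makes the lower bound c for |p_t(r)|^2
independent of r, so that it can be averaged over [0, t0]. *)
Lemma sqr_pt_le t0 t : 0 < t0 -> t0 <= t -> t <= T ->
  L2_norm (pt t) ^+ 2 <=
  t0^-1 * \int[lebesgue_measure]_(tau in `[0, t0]) (L2_norm (pt tau) ^+ 2) +
  \int[lebesgue_measure]_(tau in `[0, t]) (L2_norm (pt tau) ^+ 2) +
  \int[lebesgue_measure]_(tau in `[0, t]) (L2_norm (ft tau) ^+ 2).
Proof.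
move=> t00 t0t tT; have t_ge0 : 0 <= t by rewrite (le_trans _ t0t)// ltW.
have sub := sub0T (lexx 0) tT.
have cft : {within `[0, t], continuous (fun t => L2_norm (ft t) ^+ 2)}.
  by apply: continuous_subspaceW sub _; apply: sqr_cont; case: Cf.
have cpt : {within `[0, t], continuous (fun t => L2_norm (pt t) ^+ 2)}.
  by apply: continuous_subspaceW sub _; apply: sqr_cont; case: Cp.
have intft := continuous_itv_integrable t_ge0 cft.
have intpt := continuous_itv_integrable t_ge0 cpt.
pose g tau := L2_norm (pt tau) ^+ 2 + L2_norm (ft tau) ^+ 2.
have intg : lebesgue_measure.-integrable `[0, t] (EFin \o g).
  by apply: continuous_itv_integrable => // r; apply: cvgD; [exact: cpt|exact: cft].
have g0 r : 0 <= g r by rewrite addr_ge0// sqr_ge0.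
pose c := L2_norm (pt t) ^+ 2 - \int[lebesgue_measure]_(tau in `[0, t]) g tau.
have cle r : 0 <= r -> r <= t -> c <= L2_norm (pt r) ^+ 2.
  move=> r0 rt; have := pt_le_integral r0 rt tT; rewrite -/g.
  have arith (x y I J : R) : I <= J -> x - y <= I -> x - J <= y.
    by move=> IJ xy; lra.
  apply: arith.
  have sr : `[r, t]%classic `<=` `[0, t]%classic by exact: subset_itvScc.
  rewrite -lee_fin /Rintegral !fineK.
  - apply: ge0_subset_integral => //=; last by move=> x _; rewrite lee_fin.
    by have /integrableP[] := intg.
  - exact: integrable_fin_num.
  - apply: integrable_fin_num => //; exact: integrableS intg.
have : c * t0 <= \int[lebesgue_measure]_(tau in `[0, t0]) (L2_norm (pt tau) ^+ 2).
  have -> : c * t0 = \int[lebesgue_measure]_(tau in `[0, t0]) c.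
    rewrite Rintegral_cst//= lebesgue_measure_itv/= lte_fin t00.
    by rewrite sube0.
  have s0 : `[0, t0]%classic `<=` `[0, t]%classic by exact: subset_itvScc.
  apply: le_Rintegral => //.
  - by apply: continuous_itv_integrable; [exact: ltW|move=> r; exact: cvg_cst].
  - exact: integrableS intpt.
  - by move=> r /=; rewrite in_itv/= => /andP[r0 rt0]; apply: cle => //; exact: le_trans t0t.
have arith (x I J K : R) : (x - (J + K)) * t0 <= I -> x <= t0^-1 * I + J + K.
  by rewrite -ler_pdivlMr// mulrC => h; lra.
rewrite /c RintegralD//; exact: arith.
Qed.

End solution.

(** * The bound for the time derivative *)

Theorem theorem4p2 (R : realType) (d : nat) (hd : (2 <= d)%N)
    (Omega : set 'rV[R]_d) (hOmega : C2_bounded_domain Omega)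
    (N : nat) (a alpha : 'I_N.+1 -> R) (hg : forchheimer_data a alpha) :
  exists2 C : R, 0 < C &
    forall (T : R) (f ft : R -> 'rV[R]_d -> R) (p0 : 'rV[R]_d -> R)
      (p pt : R -> 'rV[R]_d -> R) (s u : R -> 'rV[R]_d -> 'rV[R]_d)
      (t0 t : R),
    0 < T ->
    C1_Lq Omega +oo%E T f ft ->
    C1_Lq Omega 2%:E T p pt ->
    (forall i, C0_Lq Omega 2%:E T (fun tau x => s tau x ord0 i)) ->
    mixed_solution Omega (Kfun a alpha) T f p0 p pt s u ->
    t0 \in `]0, T[ -> t \in `[t0, T] ->
    let M := Mfun Omega (betaexp alpha) T f p s in
    L2_norm Omega (pt t) ^+ 2 <=
      C * t0^-1 * M t0
      + C * (M t + \int[lebesgue_measure]_(tau in `[0, t])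
                     (L2_norm Omega (ft tau) ^+ 2)).
Proof.
have bO : bounded_set Omega by case: hOmega.
(* c is the constant of the bound of the initial energy; the energy estimate
   then bounds the integral of |p_t|^2 over [0, r] by (2 c + 1) M(r). *)
pose c := ((a ord_max)^-1) `^ (betaexp alpha - 1).
have c0 : 0 <= c := powR_ge0 _ _.
exists (2 * c + 1); first by lra.
move=> T f ft p0 p pt s u t0 t T0 /(C1_Linfty_L2 bO) Cf Cp Cs sol.
move=> t0I tI; cbv zeta; set M := Mfun Omega _ T f p s.
have /andP[t00 t0T] : 0 < t0 < T by move: t0I; rewrite in_itv.
have /andP[t0t tT] : t0 <= t <= T by move: tI; rewrite in_itv.
have t_ge0 : 0 <= t by rewrite (le_trans _ t0t)// ltW.
have s02 : L2v Omega (s 0).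
  by move=> i; have [+ _] := Cs i; apply; rewrite in_itv/= lexx ltW.
have E0 := energy_le_Lbeta hg bO s02.
pose I (phi : R -> 'rV[R]_d -> R) r :=
  \int[lebesgue_measure]_(tau in `[0, r]) (L2_norm Omega (phi tau) ^+ 2).
have I0 phi r : 0 <= I phi r by apply: Rintegral_ge0 => x _; exact: sqr_ge0.
have IM r : 0 <= r -> r <= T -> I pt r <= (2 * c + 1) * M r.
  move=> r0 rT; apply: (le_trans (integral_sqr_pt_le hg Cf Cp Cs sol r0 rT)).
  rewrite -/(I f r) /M /Mfun -/(I f r) -/c in E0 *.
  set X := r * _.
  have X0 : 0 <= X by rewrite mulr_ge0// sqr_ge0.
  have := I0 f r; have := sqr_ge0 (L2_norm Omega (p 0)).
  have := powR_ge0 (Lq_norm Omega (betaexp alpha)%:E (fun x => enorm (s 0 x)))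
    (betaexp alpha).
  move: E0 X0.
  move: (energy _ _ _ _) (_ `^ betaexp _) (_ ^+ 2) (I f r) X => A B D F X.
  move=> AB X0 B0 D0 F0.
  have cD := mulr_ge0 c0 D0; have cF := mulr_ge0 c0 F0; have cX := mulr_ge0 c0 X0.
  have cB := mulr_ge0 c0 B0.
  rewrite mulrDl !mulrDr; lra.
have := sqr_pt_le hg Cf Cp Cs sol t00 t0t tT.
rewrite -/(I pt t0) -/(I pt t) -/(I ft t) => main; apply: (le_trans main).
have t0inv : 0 <= t0^-1 by rewrite invr_ge0 ltW.
have arith (K i P0 Pt F m0 m : R) : 1 <= K -> 0 <= i -> 0 <= F -> P0 <= K * m0 ->
    Pt <= K * m -> i * P0 + Pt + F <= K * i * m0 + K * (m + F).
  move=> K1 i0 F0 h0 h; have iP := ler_wpM2l i0 h0.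
  have KF : F <= K * F by rewrite ler_peMl.
  have -> : K * i * m0 = i * (K * m0) by ring.
  lra.
apply: arith => //; [lra|exact: IM (ltW t00) (ltW t0T)|exact: IM].
Qed.
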